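(* Let $n\in\mathbb N$ and $H>0$. There is a constant $C(H)>0$ depending only on $H$ such that, for any quadruplet $q\in\mathcal Q_n$ satisfying $|||q|||\le H$, one has $$|||q-\Pi_n(q)|||\ \le\ (n+1)\,C(H)\,\max\left\{\|\varepsilon(q)\|,\ \|\varepsilon(q)\|^{2^{-(2n+1)}}\right\}.$$
   Context: **Polynomials and quadruplets.** $\mathbb N=\{0,1,2,\dots\}$. $P_n$ is the set of real univariate polynomials of degree at most $n$, with $P_{-1}=\{0\}$; $w(x)=x(1-x)$. Put $\mathcal Q_n=P_n\times P_{n-1}\times P_n\times P_{n-1}$ and $\mathcal Q_\infty=\bigcup_n\mathcal Q_n$, with componentwise addition and real scalar multiplication. For $q=(a,b,c,d)$ let $M(q)=a^2+b^2w+c^2+d^2w$ (for $q\in\mathcal Q_n$, $M(q)\in P_{2n}$), $\overline q=(a,-b,-c,-d)$, and $\mathcal U_n=\{q\in\mathcal Q_n: M(q)=1\}$. The product of $r=(\alpha,\beta,\gamma,\delta)$ and $q=(a,b,c,d)$ is $rq=(A,B,C,D)$ with $A=\alpha a-\beta bw-\gamma c-\delta dw$, $B=\beta a+\alpha b-\delta c+\gamma d$, $C=\gamma a+\delta bw+\alpha c-\beta dw$, $D=\delta a-\gamma b+\beta c+\alpha d$ (an associative product). **Norms.** For a polynomial $p$, $\|p\|=\int_0^1|p(x)|\,w(x)^{-1/2}\,dx$. For $q\in\mathcal Q_n$, $|||q|||=\|M(q)\|^{1/2}$ and $\varepsilon(q)=M(q)-1$. **Chebyshev coefficients.** $T_n,U_n$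 are the polynomials with $T_n\big(\frac{\cos\theta+1}2\big)=\cos(n\theta)$ and $U_n\big(\frac{\cos\theta+1}2\big)=\frac{2\sin(n\theta)}{\sin\theta}$ (degrees $n$ and $n-1$). For $(a,b,c,d)\in\mathcal Q_n$ write $a=\sum_{i=0}^na_iT_i$, $c=\sum_{i=0}^nc_iT_i$, $b=\sum_{i=1}^nb_iU_i$, $d=\sum_{i=1}^nd_iU_i$; and write $M(q)=\sum_{i=0}^{2n}M(q)_iT_i$. For $n\ge1$ let $\mathcal U_n^{(1)}=\{q\in\mathcal Q_n: M(q)_{2n}=M(q)_{2n-1}=0\}$. **Correction functions $\chi_n:\mathcal Q_n\to\mathcal U_n^{(1)}$.** Let $S=\begin{pmatrix}1&0\\0&0\end{pmatrix}$, $T=\begin{pmatrix}0&1\\1&0\end{pmatrix}$. *Case $n\ge2$.* Let $A=\mathrm{diag}(S,-S,S,-S)$ and $B=\mathrm{diag}(T,-T,T,-T)$ (block diagonal $8\times8$ matrices), $M_{\lambda,\mu}=I+\lambda A+\mu B$, $\mathcal D=\{(\lambda,\mu)\in\mathbb R^2: M_{\lambda,\mu}>0\}=\{|\lambda|+\mu^2<1\}$ and $G_X(\lambda,\mu)=X^tM_{\lambda,\mu}^{-1}X$ for $X\in\mathbb R^8$. Label the coordinates of $X\in\mathbb R^8$ as $(a_n,a_{n-1},b_n,b_{n-1},c_n,c_{n-1},d_n,d_{n-1})$ and let $\mathcal S=\{X: a_nc_{n-1}\ne a_{n-1}c_n,\ b_nd_{n-1}\ne b_{n-1}d_n\}$,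 an open dense set; for $X\in\mathcal S$, $G_X$ attains its infimum on $\mathcal D$. For $X\in\mathcal S$ put $\chi(X)=M_{\lambda^*,\mu^*}^{-1}X$ where $(\lambda^*,\mu^* )\in\mathcal D$ is a (chosen) global minimizer of $G_X$ on $\mathcal D$. For $X\notin\mathcal S$, $\chi(X)$ is defined by perturbation: $\chi(X)$ is a (chosen) limit of a convergent sequence $\chi(X_k)$ with $X_k\in\mathcal S$, $X_k\to X$. Then $\chi_n(a,b,c,d)=(\hat a,\hat b,\hat c,\hat d)$, where the Chebyshev coefficients of index $\le n-2$ are unchanged and $(\hat a_n,\hat a_{n-1},\hat b_n,\hat b_{n-1},\hat c_n,\hat c_{n-1},\hat d_n,\hat d_{n-1})=\chi(a_n,a_{n-1},b_n,b_{n-1},c_n,c_{n-1},d_n,d_{n-1})$. *Case $n=1$.* Let $\tilde A=\mathrm{diag}(S,-1,S,-1)$, $\tilde B=\mathrm{diag}(T,0,T,0)$ ($6\times6$), $\tilde M_{\lambda,\mu}=I+\lambda\tilde A+\mu\tilde B$, $\tilde{\mathcal D}=\{\mu^2-1<\lambda<1\}$ (the set where $\tilde M_{\lambda,\mu}>0$), $\tilde G_X(\lambda,\mu)=X^t\tilde M_{\lambda,\mu}^{-1}X$ for $X=(a_1,a_0,b_1,c_1,c_0,d_1)\in\mathbb R^6$. On the open dense set $\tilde{\mathcal S}=\{a_1c_0\ne a_0c_1,\ (b_1,d_1)\neq(0,0)\}$ put $\tilde\chi(X)=\tilde M_{\lambda^*,\mu^*}^{-1}X$ with $(\lambda^*,\mu^*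 )$ a (chosen) global minimizer of $\tilde G_X$ on $\tilde{\mathcal D}$; outside $\tilde{\mathcal S}$, $\tilde\chi(X)$ is a (chosen) limit of a convergent sequence $\tilde\chi(X_k)$ with $X_k\in\tilde{\mathcal S}$, $X_k\to X$. Then $\chi_1(a,b,c,d)=(\hat a_1T_1+\hat a_0,\hat b_1U_1,\hat c_1T_1+\hat c_0,\hat d_1U_1)$ with $(\hat a_1,\hat a_0,\hat b_1,\hat c_1,\hat c_0,\hat d_1)=\tilde\chi(a_1,a_0,b_1,c_1,c_0,d_1)$. **Factorization functions $\phi_n:\mathcal U_n^{(1)}\to\mathcal U_1$, $n\ge1$.** Let $\hat q=(\hat a,\hat b,\hat c,\hat d)\in\mathcal U_n^{(1)}$. If $\hat a_n^2+\hat c_n^2=0$, $\phi_n(\hat q)=(1,0,0,0)$. Otherwise: for $n=1$, $\phi_1(\hat q)=K\,\overline{\hat q}$ with $K=M(\hat q)^{-1/2}$ ($M(\hat q)$ being a positive constant); for $n\ge2$, $\phi_n(\hat q)=K(\alpha_1T_1+\alpha_0,\ \beta_1U_1,\ \gamma_1T_1+\gamma_0,\ \delta_1U_1)$ with $\alpha_1=\hat a_n$, $\beta_1=-\hat b_n$, $\gamma_1=-\hat c_n$, $\delta_1=-\hat d_n$, $$\alpha_0=\frac{\hat a_{n-1}}2-\frac{\hat b_n\hat b_{n-1}+\hat d_n\hat d_{n-1}}{2(\hat a_n^2+\hat c_n^2)}\hat a_n+\frac{\hat b_n\hat d_{n-1}-\hat d_n\hat b_{n-1}}{2(\hat a_n^2+\hat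 c_n^2)}\hat c_n,$$ $$\gamma_0=-\frac{\hat c_{n-1}}2+\frac{\hat b_n\hat b_{n-1}+\hat d_n\hat d_{n-1}}{2(\hat a_n^2+\hat c_n^2)}\hat c_n+\frac{\hat b_n\hat d_{n-1}-\hat d_n\hat b_{n-1}}{2(\hat a_n^2+\hat c_n^2)}\hat a_n,$$ $K=\big(\alpha_0^2+\gamma_0^2+\tfrac12(\alpha_1^2+\beta_1^2+\gamma_1^2+\delta_1^2)\big)^{-1/2}$. One has $\phi_n(\hat q)\hat q\in\mathcal Q_{n-1}$. **Projection $\Pi_n:\mathcal Q_n\to\mathcal U_n$.** Given $q\in\mathcal Q_n$, set $q_n=q$ and for $i=0,\dots,n-1$: $\hat q_{n-i}=\chi_{n-i}(q_{n-i})\in\mathcal U_{n-i}^{(1)}$, $e_{i+1}=\phi_{n-i}(\hat q_{n-i})\in\mathcal U_1$, $q_{n-(i+1)}=e_{i+1}\hat q_{n-i}\in\mathcal Q_{n-(i+1)}$. Let $r_0=q_0/M(q_0)^{1/2}$ if $q_0\ne0$ ($M(q_0)$ is a constant) and $r_0=(1,0,0,0)$ otherwise. Then $\Pi_n(q)=\overline{e_1}\,\overline{e_2}\cdots\overline{e_n}\,r_0$. Here the choices of minimizers (and limits) in the correction functions are arbitrary but fixed. *)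

(* Defs.v *)
From mathcomp Require Import all_boot all_order all_algebra.
From mathcomp Require Import ring lra.
From mathcomp Require Import all_classical all_reals all_analysis.

Set Implicit Arguments.
Unset Strict Implicit.
Unset Printing Implicit Defensive.

Import Order.TTheory GRing.Theory Num.Theory.
Import numFieldNormedType.Exports.

Local Open Scope classical_set_scope.
Local Open Scope ring_scope.

Section Quadruplets.
Context {R : realType}.

Definition wpoly : {poly R} := 'X * (1 - 'X).

(* Addition, opposite and scaling are the componentwise ones of the product
   type; the product of quadruplets is [qmul] below, never [*%R]. *)
Definition quad : Type := ({poly R} * {poly R} * {poly R} * {poly R})%type.

Definition inQ (n : nat) (q : quad) : Prop :=
  let: (a, b, c, d) := q in
  [/\ (size a <= n.+1)%N, (size b <= n)%N, (size c <= n.+1)%N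
    & (size d <= n)%N].

Definition Mq (q : quad) : {poly R} :=
  let: (a, b, c, d) := q in
  a ^+ 2 + b ^+ 2 * wpoly + c ^+ 2 + d ^+ 2 * wpoly.

Definition qconj (q : quad) : quad :=
  let: (a, b, c, d) := q in (a, - b, - c, - d).

Definition qone : quad := (1, 0, 0, 0).

Definition qmul (r q : quad) : quad :=
  let: (al, be, ga, de) := r in
  let: (a, b, c, d) := q in
  ( al * a - be * b * wpoly - ga * c - de * d * wpoly,
    be * a + al * b - de * c + ga * d,
    ga * a + de * b * wpoly + al * c - be * d * wpoly,
    de * a - ga * b + be * c + al * d ).

Lemma qmulA (p q r : quad) : qmul p (qmul q r) = qmul (qmul p q) r.
Proof.
case: p => [[[? ?] ?] ?]; case: q => [[[? ?] ?] ?]; case: r => [[[? ?] ?] ?].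
by rewrite /qmul; congr (_, _, _, _); ring.
Qed.

(* The integrand is Lebesgue integrable, so the real-valued integral does not
   take its default value. *)
Definition pnorm (p : {poly R}) : R :=
  \int[lebesgue_measure]_(x in `]0, 1[) (`|p.[x]| / Num.sqrt (wpoly.[x])).

Definition qnorm (q : quad) : R := Num.sqrt (pnorm (Mq q)).

Definition qeps (q : quad) : {poly R} := Mq q - 1.

End Quadruplets.
Arguments quad R : clear implicits.

Section Chebyshev.
Context {R : realType}.

(* The three-term recurrences; [chebT_cos] and [chebU_sin] are the defining
   trigonometric identities of these shifted polynomials. *)
Fixpoint chebT (n : nat) : {poly R} :=
  match n with
  | 0 => 1
  | 1 => 2 *: 'X - 1
  | (m.+1 as k).+1 => 2 *: ((2 *: 'X - 1) * chebT k) - chebT m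
  end.

Fixpoint chebU (n : nat) : {poly R} :=
  match n with
  | 0 => 0
  | 1 => 2%:P
  | (m.+1 as k).+1 => 2 *: ((2 *: 'X - 1) * chebU k) - chebU m
  end.

Lemma chebTSS n :
  chebT n.+2 = 2 *: ((2 *: 'X - 1) * chebT n.+1) - chebT n.
Proof. by []. Qed.

Lemma chebUSS n :
  chebU n.+2 = 2 *: ((2 *: 'X - 1) * chebU n.+1) - chebU n.
Proof. by []. Qed.

Lemma chebT_cos n (t : R) : (chebT n).[(cos t + 1) / 2] = cos (n%:R * t).
Proof.
elim/ltn_ind: n => -[|[|n]] IH.
- by rewrite /= !hornerE cos0.
- by rewrite /= !hornerE /=; field.
rewrite chebTSS hornerD hornerN hornerZ hornerM !IH ?ltnS // !hornerE /=.
have -> : n.+2%:R * t = n.+1%:R * t + t by rewrite -[n.+2]addn1 natrD; ring.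
have -> : n%:R * t = n.+1%:R * t - t by rewrite -[n.+1]addn1 natrD; ring.
by rewrite cosB cosD; field.
Qed.

Lemma chebU_sin n (t : R) :
  (chebU n).[(cos t + 1) / 2] * sin t = 2 * sin (n%:R * t).
Proof.
elim/ltn_ind: n => -[|[|n]] IH.
- by rewrite /= !hornerE sin0; ring.
- by rewrite /= !hornerE.
rewrite chebUSS hornerD hornerN hornerZ hornerM mulrBl -!mulrA !IH ?ltnS // !hornerE /=.
have -> : n.+2%:R * t = n.+1%:R * t + t by rewrite -[n.+2]addn1 natrD; ring.
have -> : n%:R * t = n.+1%:R * t - t by rewrite -[n.+1]addn1 natrD; ring.
by rewrite sinB sinD; field.
Qed.

Lemma size_cheb_step (p r : {poly R}) (k : nat) :
  size p = k.+1 -> (size r <= k.+1)%N ->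
  size (2 *: ((2 *: 'X - 1) * p) - r) = k.+2.
Proof.
move=> sp sr.
have sl : size (2 *: 'X - 1 : {poly R}) = 2.
  by rewrite size_polyDl ?size_polyN ?size_poly1 size_scale ?pnatr_eq0 ?size_polyX.
have st : size (2 *: ((2 *: 'X - 1) * p)) = k.+2.
  rewrite size_scale ?pnatr_eq0 // size_mul -?size_poly_eq0 ?sl ?sp //.
by rewrite size_polyDl ?size_polyN st.
Qed.

Lemma size_chebT n : size (chebT n) = n.+1.
Proof.
elim/ltn_ind: n => -[|[|n]] IH; first by rewrite /= size_poly1.
  by rewrite /= size_polyDl ?size_polyN ?size_poly1 size_scale ?pnatr_eq0 ?size_polyX.
by rewrite chebTSS (@size_cheb_step _ _ n.+1) ?IH ?ltnS.
Qed.

Lemma size_chebU n : size (chebU n.+1) = n.+1.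
Proof.
elim/ltn_ind: n => -[|[|n]] IH.
- by rewrite /= size_polyC pnatr_eq0.
- rewrite chebUSS (@size_cheb_step _ _ 0) //=; first by rewrite size_polyC pnatr_eq0.
  by rewrite size_poly0.
by rewrite chebUSS (@size_cheb_step _ _ n.+1) ?IH ?ltnS.
Qed.

Definition is_expansion (B : nat -> {poly R}) (p : {poly R}) (c : nat -> R) :=
  (p = \sum_(i < size p) c i *: B i) /\
  (forall i, (size p <= i)%N -> c i = 0).

Lemma expansion_ex (B : nat -> {poly R}) (p : {poly R}) :
  (forall i, size (B i) = i.+1) -> exists c, is_expansion B p c.
Proof.
move=> sB; suff H : forall k (r : {poly R}), (size r <= k)%N -> exists c : nat -> R,
    (r = \sum_(i < k) c i *: B i) /\ (forall i, (k <= i)%N -> c i = 0).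
  exact: H (leqnn _).
elim=> [|k IH] r sr.
  exists (fun=> 0); split=> //; rewrite big_ord0.
  by apply/eqP; rewrite -size_poly_leq0.
have Bk : (B k)`_k != 0.
  by rewrite -[k in _`_k]/(k.+1.-1) -(sB k) -lead_coefE lead_coef_eq0 -size_poly_eq0 sB.
pose x := r`_k / (B k)`_k.
have /IH[c [rE c0]] : (size (r - x *: B k)%R <= k)%N.
  apply/leq_sizeP => j; rewrite leq_eqVlt => /orP[/eqP<-|kj].
    by rewrite coefB coefZ /x divfK ?subrr.
  by rewrite coefB coefZ !nth_default ?sB ?mulr0 ?subrr // (leq_trans sr).
exists (fun i => if i == k then x else c i); split=> [|i ki]; last first.
  by rewrite gtn_eqF // c0 // ltnW.
rewrite big_ord_recr /= eqxx; apply/eqP; rewrite -subr_eq; apply/eqP.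
by rewrite rE; apply: eq_bigr => i _; rewrite ltn_eqF.
Qed.

Lemma expansion_uniq (B : nat -> {poly R}) (p : {poly R}) (c c' : nat -> R) :
  (forall i, size (B i) = i.+1) -> is_expansion B p c ->
  is_expansion B p c' -> c =1 c'.
Proof.
move=> sB [pc c0] [pc' c0'] i.
have [|ip] := leqP (size p) i; first by move=> ip; rewrite c0 // c0'.
have : \sum_(i < size p) (c i - c' i) *: B i = 0.
  under eq_bigr do rewrite scalerBl.
  by rewrite sumrB -pc -pc' subrr.
elim: (size p) ip => // k IH; rewrite ltnS big_ord_recr /= => ik S0.
have sS : (size (\sum_(j < k) (c j - c' j) *: B j)%R <= k)%N.
  apply: (leq_trans (size_sum _ _ _)); apply/bigmax_leqP => j _.
  by rewrite (leq_trans (size_scale_leq _ _)) // sB.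
have Bk : (B k)`_k != 0.
  by rewrite -[k in _`_k]/(k.+1.-1) -(sB k) -lead_coefE lead_coef_eq0 -size_poly_eq0 sB.
have ck : c k - c' k = 0.
  have /eqP : (\sum_(j < k) (c j - c' j) *: B j + (c k - c' k) *: B k)`_k = 0.
    by rewrite S0 coef0.
  by rewrite coefD coefZ nth_default // add0r mulf_eq0 (negPf Bk) orbF => /eqP.
move: ik; rewrite leq_eqVlt => /orP[/eqP ->|ik].
  by apply/eqP; rewrite -subr_eq0 ck.
by apply: IH => //; move: S0; rewrite ck scale0r addr0.
Qed.

Definition expansion (B : nat -> {poly R}) (p : {poly R}) : nat -> R :=
  xget (fun=> 0) [set c | is_expansion B p c].

Definition chebT_coef (p : {poly R}) (i : nat) : R := expansion chebT p i.

(* The family [chebU] is indexed from 1. *)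
Definition chebU_coef (p : {poly R}) (i : nat) : R :=
  if i is j.+1 then expansion (fun k => chebU k.+1) p j else 0.

Lemma chebT_coefE n (p : {poly R}) : (size p <= n.+1)%N ->
  p = \sum_(0 <= i < n.+1) chebT_coef p i *: chebT i.
Proof.
move=> sp.
have [pE c0] := xgetPex (fun=> 0) (expansion_ex p size_chebT).
rewrite {1}pE -(big_mkord xpredT (fun i => chebT_coef p i *: chebT i)).
rewrite (big_cat_nat _ sp) //= [X in _ = _ + X]big_nat [X in _ = _ + X]big1 ?addr0 // => i /andP[pi _].
by rewrite [chebT_coef _ _]c0 // scale0r.
Qed.

Lemma chebU_coefE n (p : {poly R}) : (size p <= n)%N ->
  p = \sum_(1 <= i < n.+1) chebU_coef p i *: chebU i.
Proof.
move=> sp.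
have [pE c0] := xgetPex (fun=> 0) (expansion_ex p size_chebU).
rewrite {1}pE big_add1 /=.
rewrite -(big_mkord xpredT (fun i => chebU_coef p i.+1 *: chebU i.+1)).
rewrite (big_cat_nat _ sp) //= [X in _ = _ + X]big_nat [X in _ = _ + X]big1 ?addr0 // => i /andP[pi _].
by rewrite [expansion _ _ _]c0 // scale0r.
Qed.

End Chebyshev.

Section Correction.
Context {R : realType}.

Definition posdef (N : nat) (A : 'M[R]_N) : Prop :=
  forall v : 'cV[R]_N, v != 0 -> 0 < (v^T *m A *m v) 0 0.

Section Pencil.
Context {N : nat} (A B : 'M[R]_N).

Definition pencil (l m : R) : 'M[R]_N := 1%:M + l *: A + m *: B.

Definition pencil_dom : set (R * R) := [set z | posdef (pencil z.1 z.2)].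

Definition pencil_form (X : 'cV[R]_N) (l m : R) : R :=
  (X^T *m invmx (pencil l m) *m X) 0 0.

(* [chi] is an admissible outcome of the arbitrary choices: a global minimizer
   on the dense set [S], and outside [S] a limit of values taken on [S]. *)
Definition correction_map (S : set 'cV[R]_N) (chi : 'cV[R]_N -> 'cV[R]_N) :=
  (forall X, S X -> exists z, [/\ pencil_dom z,
     (forall z', pencil_dom z' ->
        pencil_form X z.1 z.2 <= pencil_form X z'.1 z'.2)
     & chi X = invmx (pencil z.1 z.2) *m X]) /\
  (forall X, ~ S X -> exists Xs : nat -> 'cV[R]_N,
     [/\ (forall k, S (Xs k)), Xs @ \oo --> X
       & (fun k => chi (Xs k)) @ \oo --> chi X]).

End Pencil.

Definition Smx : 'M[R]_2 := delta_mx 0 0.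
Definition Tmx : 'M[R]_2 := delta_mx 0 1 + delta_mx 1 0.

(* The 2-vector (x_n, x_{n-1}): top coefficient first. *)
Definition col2 (x y : R) : 'cV[R]_2 := \col_i (if i == 0 then x else y).

Definition diag4 (m n : nat) (P : 'M[R]_m) (Q : 'M[R]_n) :
    'M[R]_((m + n) + (m + n)) :=
  block_mx (block_mx P 0 0 Q) 0 0 (block_mx P 0 0 Q).

Definition col4 (m n : nat) (a : 'cV[R]_m) (b : 'cV[R]_n) (c : 'cV[R]_m)
    (d : 'cV[R]_n) : 'cV[R]_((m + n) + (m + n)) :=
  col_mx (col_mx a b) (col_mx c d).

Definition blka (m n : nat) (X : 'cV[R]_((m + n) + (m + n))) : 'cV[R]_m :=
  usubmx (usubmx X).
Definition blkb (m n : nat) (X : 'cV[R]_((m + n) + (m + n))) : 'cV[R]_n :=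
  dsubmx (usubmx X).
Definition blkc (m n : nat) (X : 'cV[R]_((m + n) + (m + n))) : 'cV[R]_m :=
  usubmx (dsubmx X).
Definition blkd (m n : nat) (X : 'cV[R]_((m + n) + (m + n))) : 'cV[R]_n :=
  dsubmx (dsubmx X).

(* Degree n >= 2: X = (a_n, a_{n-1}, b_n, b_{n-1}, c_n, c_{n-1}, d_n, d_{n-1}). *)
Notation vec8 := 'cV[R]_((2 + 2) + (2 + 2)).

Definition A8 := diag4 Smx (- Smx).
Definition B8 := diag4 Tmx (- Tmx).

Definition S8 : set vec8 := [set X |
  blka X 0 0 * blkc X 1 0 != blka X 1 0 * blkc X 0 0 /\
  blkb X 0 0 * blkd X 1 0 != blkb X 1 0 * blkd X 0 0].

(* Degree n = 1: X = (a_1, a_0, b_1, c_1, c_0, d_1). *)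
Notation vec6 := 'cV[R]_((2 + 1) + (2 + 1)).

Definition A6 := diag4 Smx (- 1 : 'M[R]_1).
Definition B6 := diag4 Tmx (0 : 'M[R]_1).

Definition S6 : set vec6 := [set X |
  blka X 0 0 * blkc X 1 0 != blka X 1 0 * blkc X 0 0 /\
  (blkb X 0 0, blkd X 0 0) != (0, 0)].

Lemma diag4_form m n (P : 'M[R]_m) (Q : 'M[R]_n) a b c d :
  ((col4 a b c d)^T *m diag4 P Q *m col4 a b c d) 0 0 =
  (a^T *m P *m a) 0 0 + (b^T *m Q *m b) 0 0
  + ((c^T *m P *m c) 0 0 + (d^T *m Q *m d) 0 0).
Proof.
rewrite /col4 /diag4 !tr_col_mx !mul_row_block !(mulmx0, addr0, add0r).
have addE (U V : 'M[R]_1) : (U + V) 0 0 = U 0 0 + V 0 0 by rewrite mxE.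
by rewrite !mul_row_col !addE.
Qed.

Lemma diag4_pencil m n (P P' : 'M[R]_m) (Q Q' : 'M[R]_n) l u :
  pencil (diag4 P Q) (diag4 P' Q') l u =
  diag4 (pencil P P' l u) (pencil Q Q' l u).
Proof.
rewrite /pencil /diag4 !scalar_mx_block !scale_block_mx !add_block_mx.
by rewrite !scaler0 !addr0.
Qed.

Lemma col4_blk m n (X : 'cV[R]_((m + n) + (m + n))) :
  X = col4 (blka X) (blkb X) (blkc X) (blkd X).
Proof. by rewrite /col4 !vsubmxK. Qed.

Lemma posdef_diag4 m n (P : 'M[R]_m) (Q : 'M[R]_n) :
  posdef (diag4 P Q) <-> posdef P /\ posdef Q.
Proof.
have form0 k (W : 'M[R]_k) : ((0 : 'cV_k)^T *m W *m 0) 0 0 = 0.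
  by rewrite mulmx0 mxE.
have pos k (W : 'M[R]_k) (v : 'cV_k) : posdef W -> 0 <= (v^T *m W *m v) 0 0.
  by move=> pW; have [->|v0] := eqVneq v 0; [rewrite form0 | exact: ltW (pW v v0)].
split=> [pd|[pP pQ] v].
  split=> v v0.
    have := pd (col4 v 0 0 0); rewrite diag4_form !form0 !addr0; apply.
    by apply: contra_neq v0 => /eqP; rewrite /col4 !col_mx_eq0 => /andP[/andP[/eqP]].
  have := pd (col4 0 v 0 0); rewrite diag4_form !form0 !addr0 !add0r; apply.
  by apply: contra_neq v0 => /eqP; rewrite /col4 !col_mx_eq0 => /andP[/andP[_ /eqP]].
rewrite (col4_blk v) diag4_form /col4 !col_mx_eq0.
set a := blka v; set b := blkb v; set c := blkc v; set d := blkd v.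
have := (pos _ _ a pP, pos _ _ b pQ, pos _ _ c pP, pos _ _ d pQ).
case=> -[[ha hb] hc] hd; rewrite !negb_and.
by case/orP => /orP[] h;
   [have := pP _ h | have := pQ _ h | have := pP _ h | have := pQ _ h]; lra.
Qed.

Lemma pencil2_form (l u : R) (v : 'cV[R]_2) :
  (v^T *m pencil Smx Tmx l u *m v) 0 0 =
  (1 + l) * v 0 0 ^+ 2 + 2 * u * v 0 0 * v 1 0 + v 1 0 ^+ 2.
Proof.
have sum2 (F : 'I_2 -> R) : \sum_i F i = F 0 + F 1.
  by rewrite big_ord_recl big_ord1; congr (_ + F _); exact/val_inj.
rewrite mxE sum2 !mxE !sum2 !mxE /=; ring.
Qed.

Lemma posdef_pencil2 (l u : R) : posdef (pencil Smx Tmx l u) <-> u ^+ 2 < 1 + l.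
Proof.
split=> [/(_ (col2 1 (- u)))|lu v v0].
  rewrite pencil2_form !mxE /= => h.
  suff: 0 < (1 + l) * 1 ^+ 2 + 2 * u * 1 * - u + (- u) ^+ 2 by lra.
  apply: h; apply/eqP => /matrixP/(_ 0 0); rewrite !mxE /= => /eqP.
  by rewrite oner_eq0.
rewrite pencil2_form.
have -> : (1 + l) * v 0 0 ^+ 2 + 2 * u * v 0 0 * v 1 0 + v 1 0 ^+ 2 =
  (1 + l - u ^+ 2) * v 0 0 ^+ 2 + (u * v 0 0 + v 1 0) ^+ 2 by ring.
have [x0|x0] := eqVneq (v 0 0) 0; last first.
  rewrite ltr_pwDl ?sqr_ge0 // mulr_gt0 ?subr_gt0 //.
  by rewrite lt_neqAle sqr_ge0 eq_sym sqrf_eq0 x0.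
rewrite x0 expr0n /= !mulr0 !add0r lt_neqAle sqr_ge0 eq_sym sqrf_eq0 andbT.
apply: contra_neq v0 => y0; apply/colP => i; rewrite mxE.
by case: (unliftP 0 i) => [j|] ->; [rewrite (_ : lift _ _ = 1) //; apply/val_inj; rewrite /= ord1|].
Qed.

Lemma pencilN N (A B : 'M[R]_N) l u :
  pencil (- A) (- B) l u = pencil A B (- l) (- u).
Proof. by rewrite /pencil !scalerN !scaleNr. Qed.

Lemma pencil_dom8E : pencil_dom A8 B8 = [set z | `|z.1| + z.2 ^+ 2 < 1].
Proof.
apply/seteqP; split=> -[l u] /=; rewrite /pencil_dom /= diag4_pencil pencilN.
  move/posdef_diag4 => [/posdef_pencil2 h1 /posdef_pencil2].
  by rewrite sqrrN => h2; have [?|?] := ler0P l; lra.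
move=> h; apply/posdef_diag4; split; apply/posdef_pencil2; rewrite ?sqrrN.
  by move: h (ler_norm (- l)); rewrite normrN; lra.
by move: h (ler_norm l); lra.
Qed.

Lemma pencil_dom6E : pencil_dom A6 B6 = [set z | z.2 ^+ 2 - 1 < z.1 < 1].
Proof.
have pd1 (x : R) : posdef (x%:M : 'M[R]_1) <-> 0 < x.
  have E (v : 'cV[R]_1) : (v^T *m x%:M *m v) 0 0 = x * v 0 0 ^+ 2.
    by rewrite mul_mx_scalar -scalemxAl !mxE big_ord1 !mxE.
  split=> [/(_ 1%:M)|x0 v v0].
    by rewrite E !mxE /= expr1n mulr1; apply; apply: oner_neq0.
  rewrite E mulr_gt0 // lt_neqAle sqr_ge0 eq_sym sqrf_eq0 andbT.
  by apply: contra_neq v0 => y0; apply/colP => i; rewrite mxE ord1.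
have p1 l u : pencil (- 1 : 'M[R]_1) 0 l u = (1 - l)%:M.
  rewrite /pencil scaler0 addr0 scalerN.
  by have -> : l *: 1 = l%:M :> 'M[R]_1; rewrite ?scalemx1 // -raddfB.
apply/seteqP; split=> -[l u] /=; rewrite /pencil_dom /= diag4_pencil p1.
  by move/posdef_diag4 => [/posdef_pencil2 h1 /pd1 h2]; apply/andP; split; lra.
move=> /andP[h1 h2]; apply/posdef_diag4.
by split; [apply/posdef_pencil2|apply/pd1]; lra.
Qed.

(* The sums run over the Chebyshev coefficients of index at most n - 2. *)
Definition chi_ge2 (chi8 : vec8 -> vec8) (n : nat) (q : quad R) : quad R :=
  let: (a, b, c, d) := q in
  let tcol p := col2 (chebT_coef p n) (chebT_coef p n.-1) in
  let ucol p := col2 (chebU_coef p n) (chebU_coef p n.-1) in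
  let Y := chi8 (col4 (tcol a) (ucol b) (tcol c) (ucol d)) in
  let tpoly p y := \sum_(0 <= i < n.-1) chebT_coef p i *: chebT i
    + (y 0 0 *: chebT n + y 1 0 *: chebT n.-1) in
  let upoly p y := \sum_(1 <= i < n.-1) chebU_coef p i *: chebU i
    + (y 0 0 *: chebU n + y 1 0 *: chebU n.-1) in
  (tpoly a (blka Y), upoly b (blkb Y), tpoly c (blkc Y), upoly d (blkd Y)).

Definition chi_1 (chi6 : vec6 -> vec6) (q : quad R) : quad R :=
  let: (a, b, c, d) := q in
  let tcol p := col2 (chebT_coef p 1) (chebT_coef p 0) in
  let ucol p := (chebU_coef p 1)%:M in
  let Y := chi6 (col4 (tcol a) (ucol b) (tcol c) (ucol d)) in
  let tpoly y := y 0 0 *: chebT 1 + (y 1 0)%:P in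
  let upoly y := y 0 0 *: chebU 1 in
  (tpoly (blka Y), upoly (blkb Y), tpoly (blkc Y), upoly (blkd Y)).

(* Only used for n >= 1. *)
Definition chi_fun (chi8 : vec8 -> vec8) (chi6 : vec6 -> vec6) (n : nat) :
    quad R -> quad R :=
  if n == 1%N then chi_1 chi6 else chi_ge2 chi8 n.

(* Only used for n >= 1. When n = 1, [Mq q] is a constant polynomial, whose
   value is its coefficient of index 0. *)
Definition phi_fun (n : nat) (q : quad R) : quad R :=
  let: (a, b, c, d) := q in
  let an := chebT_coef a n in let an1 := chebT_coef a n.-1 in
  let bn := chebU_coef b n in let bn1 := chebU_coef b n.-1 in
  let cn := chebT_coef c n in let cn1 := chebT_coef c n.-1 in
  let dn := chebU_coef d n in let dn1 := chebU_coef d n.-1 in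
  let s := an ^+ 2 + cn ^+ 2 in
  if s == 0 then qone
  else if n == 1%N then (Num.sqrt (Mq q)`_0)^-1 *: qconj q
  else
    let al1 := an in let be1 := - bn in let ga1 := - cn in let de1 := - dn in
    let al0 := an1 / 2 - (bn * bn1 + dn * dn1) / (2 * s) * an
                       + (bn * dn1 - dn * bn1) / (2 * s) * cn in
    let ga0 := - cn1 / 2 + (bn * bn1 + dn * dn1) / (2 * s) * cn
                         + (bn * dn1 - dn * bn1) / (2 * s) * an in
    let K := (Num.sqrt (al0 ^+ 2 + ga0 ^+ 2
      + (al1 ^+ 2 + be1 ^+ 2 + ga1 ^+ 2 + de1 ^+ 2) / 2))^-1 in
    K *: ((al1 *: chebT 1 + al0%:P, be1 *: chebU 1,
           ga1 *: chebT 1 + ga0%:P, de1 *: chebU 1) : quad R).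

(* For q in Q_0, [Mq q] is a constant polynomial. *)
Definition normalize0 (q : quad R) : quad R :=
  if q == 0 then qone else (Num.sqrt (Mq q)`_0)^-1 *: q.

(* By [qmulA] the bracketing of the product conj e_1 ... conj e_n r_0 does not
   matter. *)
Fixpoint qproj (chi8 : vec8 -> vec8) (chi6 : vec6 -> vec6) (n : nat)
    (q : quad R) : quad R :=
  if n is m.+1 then
    let qh := chi_fun chi8 chi6 n q in
    let e := phi_fun n qh in
    qmul (qconj e) (qproj chi8 chi6 m (qmul e qh))
  else normalize0 q.

End Correction.

(* Main.v *)
Require Import Defs.
From HB Require Import structures.
From mathcomp Require Import all_boot all_order all_algebra.
From mathcomp Require Import ring lra zify.
From mathcomp Require Import all_classical all_reals all_analysis.
From mathcomp Require Import measurable_realfun.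

Set Implicit Arguments.
Unset Strict Implicit.
Unset Printing Implicit Defensive.

Import Order.TTheory GRing.Theory Num.Theory.
Import numFieldNormedType.Exports.

Local Open Scope classical_set_scope.
Local Open Scope ring_scope.

(** Substituting x = (cos t + 1) / 2 turns a quadruplet q into a
    quaternion-valued trigonometric polynomial whose squared modulus is M(q).
    Hence M is multiplicative, |||q||| is an L2 norm over [0, pi], and left
    multiplication by a quadruplet e with M(e) = 1 is an isometry which does
    not change the defect M(q) - 1.

    One step of the projection corrects the two leading coefficients X of q into
    Y and then lowers the degree by such an isometry ([phi_factor]).  The
    correction is small for the following reason.  Y = (I + W)^-1 X with
    W = l A + m B, where (l, m) minimizes X^t (I + l A + m B)^-1 X over an open
    set; stationarity gives Y^t A Y = Y^t B Y = 0, so Y^t W Y = 0 and, since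
    X = Y + W Y, |X|^2 = |Y|^2 + |W Y|^2.  Expanding X^t W X and using I + W > 0
    gives |X - Y|^2 = |W Y|^2 <= X^t W X <= |l| |X^t A X| + |m| |X^t B X|
    ([correction_estimate]).  Now X^t A X and X^t B X are, up to constant
    factors, the two leading Chebyshev coefficients of M(q), equivalently of
    the defect, so they are bounded by the norm eta of the defect:
    a step moves q by at most 4 sqrt eta ([projection_step]).

    The corrected quadruplet has norm at most |||q||| (at most twice that in
    degree 1), so by Cauchy-Schwarz its defect is at most c sqrt eta for a
    constant c that depends on H only.  In the variable x = eta / c^2 this reads
    x' <= sqrt x: iterating produces powers x^(2^-k) and no constant
    accumulates.  Each of the n steps, and the final normalization, thus costs
    at most 4 c^2 max(x, x^s) with s = 2^-(2n+1), and the n + 1 costs add up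
    ([qproj_dist]). *)

(** * The cosine substitution and the arcsine integral *)

Section CosineSubstitution.
Context {R : realType}.
Notation mu := (@lebesgue_measure R).
Implicit Types (p r : {poly R}) (f g : R -> R) (t : R).

Definition xi t : R := (cos t + 1) / 2.

Lemma continuous_xi : continuous xi.
Proof.
move=> t; apply: cvgM; last exact: cvg_cst.
by apply: cvgD; [exact: continuous_cos|exact: cvg_cst].
Qed.

Global Instance is_derive_xi t : is_derive t 1 xi (- sin t / 2).
Proof.
rewrite (_ : xi = fun t => (cos t + 1) * 2^-1) //.
by apply: is_derive_eq; rewrite addr0 /GRing.scale /= ?mulr0 ?add0r mulrC.
Qed.

Lemma horner_wpoly_xi t : (@wpoly R).[xi t] = (sin t / 2) ^+ 2.
Proof.
by rewrite /wpoly !hornerE /xi exprMn sin2cos2; field.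
Qed.

Lemma sqrt_wpoly_xi t : 0 <= t <= pi -> Num.sqrt (@wpoly R).[xi t] = sin t / 2.
Proof.
move=> tpi; rewrite horner_wpoly_xi sqrtr_sqr ger0_norm //.
by rewrite divr_ge0 // sin_ge0_pi.
Qed.

Lemma continuous_horner_xi p : continuous (fun t => p.[xi t]).
Proof.
move=> t; apply: (@continuous_comp _ _ _ xi (horner p)).
  exact: continuous_xi.
exact: continuous_horner.
Qed.

Lemma itv_integrable f (a b : R) : continuous f -> mu.-integrable `[a, b] (EFin \o f).
Proof.
move=> cf; apply: continuous_compact_integrable; first exact: segment_compact.
exact: continuous_subspaceT.
Qed.

Lemma xi_lt (s t : R) : 0 <= s -> s < t -> t <= pi -> xi t < xi s.
Proof.
move=> s0 st tpi; rewrite /xi ltr_pM2r ?invr_gt0 // ltrD2r.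
by rewrite ltr_cos // in_itv /=; apply/andP; split; lra.
Qed.

Lemma xi_le (s t : R) : 0 <= s -> s <= t -> t <= pi -> xi t <= xi s.
Proof.
by move=> s0; rewrite le_eqVlt => /predU1P[->//|st tpi]; exact/ltW/xi_lt.
Qed.

Lemma xi_itv01 t : 0 < t < pi -> 0 < xi t < 1.
Proof.
move=> /andP[t0 tpi]; have pi0 := pi_gt0 R.
have x0 : xi 0 = 1 by rewrite /xi cos0; lra.
have xpi : xi pi = 0 by rewrite /xi cospi; lra.
rewrite -{1}xpi -x0; apply/andP; split; apply: xi_lt => //; exact: ltW.
Qed.

(** The arcsine weight is unbounded at both ends of ]0, 1[, where the classical
    substitution theorem does not apply; it is used on the compact pieces below
    and on their images. *)
Lemma itv_pi_exhausts :
  \bigcup_n `[pi / n.+2%:R, pi - pi / n.+2%:R]%classic = `]0, pi[%classic :> set R.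
Proof.
have pi0 := pi_gt0 R; apply/seteqP; split=> t /=.
  move=> [n _ /=]; have : 0 < pi / n.+2%:R :> R by rewrite divr_gt0.
  move: (pi / _) => x x0; rewrite !in_itv /= => /andP[h1 h2].
  by apply/andP; split; lra.
rewrite in_itv /= => /andP[t0 tpi].
have m0 : 0 < Num.min t (pi - t) by rewrite lt_min t0 subr_gt0.
have k0 : 0 <= pi / Num.min t (pi - t) by rewrite divr_ge0 // ltW.
have := archi_boundP k0; set n := Num.bound _ => hn.
have : pi / n.+2%:R <= Num.min t (pi - t).
  rewrite ler_pdivrMr // mulrC -ler_pdivrMr //.
  by apply: (le_trans (ltW hn)); rewrite ler_nat ltnW // ltnW.
rewrite le_min => /andP[h1 h2].
by exists n => //=; rewrite in_itv /= h1 /= lerBrDr -lerBrDl.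
Qed.

Lemma xi_image_exhausts :
  \bigcup_n `[xi (pi - pi / n.+2%:R), xi (pi / n.+2%:R)]%classic
  = `]0, 1[%classic :> set R.
Proof.
have pi0 := pi_gt0 R.
have q0 n : 0 < pi / n.+2%:R :> R by rewrite divr_gt0.
have q1 n : pi / n.+2%:R < pi :> R by rewrite ltr_pdivrMr // ltr_pMr // ltr1n.
apply/seteqP; split=> x /=.
  move=> [n _ /=]; rewrite !in_itv /= => /andP[h1 h2].
  have /andP[_ c1] : 0 < xi (pi / n.+2%:R) < 1 by apply: xi_itv01; rewrite q0 q1.
  have /andP[c2 _] : 0 < xi (pi - pi / n.+2%:R) < 1.
    by apply: xi_itv01; rewrite subr_gt0 q1 ltrBlDr ltrDl q0.
  by rewrite (lt_le_trans c2 h1) (le_lt_trans h2 c1).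
rewrite in_itv /= => /andP[x0 x1].
have y1 : -1 < 2 * x - 1 < 1 by apply/andP; split; lra.
set t := acos (2 * x - 1).
have t0 : 0 < t by apply: acos_gt0; case/andP: y1 => /ltW -> ->.
have tpi : t < pi by apply: acos_ltpi; case/andP: y1 => -> /ltW ->.
have xt : x = xi t.
  by rewrite /xi acosK ?in_itv /=; [lra|case/andP: y1 => /ltW -> /ltW ->].
have : `]0, pi[%classic t by rewrite /= in_itv /= t0.
rewrite -itv_pi_exhausts => -[n _ /=]; rewrite in_itv /= => /andP[h1 h2].
exists n => //=; rewrite in_itv /= xt !xi_le ?(ltW t0) ?(ltW tpi) ?(ltW (q0 n)) //.
by rewrite lerBlDr lerDl ltW.
Qed.

Lemma arcsine_weight_continuous g (a b : R) :
  0 < a -> a <= b -> b < pi -> continuous g ->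
  {within `[xi b, xi a], continuous (fun x => g x / Num.sqrt (@wpoly R).[x])}.
Proof.
move=> a0 ab bpi cg; have pi0 := pi_gt0 R.
apply: continuous_in_subspaceT => x; rewrite inE /= in_itv /= => /andP[hb ha].
apply: cvgM; first exact: cg.
apply: cvgV; last first.
  apply: (@continuous_comp _ _ _ (horner wpoly) Num.sqrt); first exact: continuous_horner.
  exact: sqrt_continuous.
rewrite gt_eqF // sqrtr_gt0 /wpoly !hornerE.
have /andP[_ a1] : 0 < xi a < 1 by apply: xi_itv01; rewrite a0 (le_lt_trans ab).
have /andP[b0 _] : 0 < xi b < 1 by apply: xi_itv01; rewrite bpi (lt_le_trans a0).
by apply: mulr_gt0; lra.
Qed.

Lemma integral_arcsine_weight g (a b : R) : 0 < a -> a <= b -> b < pi -> continuous g ->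
  (\int[mu]_(x in `[xi b, xi a]) (g x / Num.sqrt (@wpoly R).[x])%:E =
   \int[mu]_(t in `[a, b]) (g (xi t))%:E)%E.
Proof.
move=> a0 ab bpi cg; have pi0 := pi_gt0 R.
have sin_gt0 t : t \in `[a, b] -> 0 < sin t.
  rewrite in_itv /= => /andP[at_ tb].
  by apply: sin_gt0_pi; rewrite (lt_le_trans a0 at_) (le_lt_trans tb bpi).
have dxi : (derive1 xi) = fun t => - sin t / 2.
  by apply/funext => t; rewrite derive1E derive_val.
have xi_decr : {in `[a, b] &, {homo xi : x y /~ x < y}}.
  move=> x y; rewrite !in_itv /= => /andP[ax xb] /andP[ay yb] xy.
  by apply: xi_lt => //; lra.
have cdxi : continuous (derive1 xi).
  rewrite dxi => t; apply: cvgM; last exact: cvg_cst.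
  by apply: cvgN; exact: continuous_sin.
have derxi : derivable_oo_LRcontinuous xi a b.
  split; [by move=> t _|by apply: cvg_at_right_filter; exact: continuous_xi|].
  by apply: cvg_at_left_filter; exact: continuous_xi.
rewrite integration_by_substitution_decreasing //.
- apply: eq_integral => t; rewrite inE => tab; congr (_%:E); rewrite !fctE dxi /=.
  have tpi : 0 <= t <= pi by move: tab; rewrite /= in_itv /= => /andP[? ?]; apply/andP; split; lra.
  rewrite sqrt_wpoly_xi //; have := sin_gt0 _ tab => s0.
  by field; rewrite gt_eqF.
- by apply/cvg_ex; exists ((derive1 xi) a); apply: cvg_at_right_filter; exact: cdxi.
- by apply/cvg_ex; exists ((derive1 xi) b); apply: cvg_at_left_filter; exact: cdxi.
- exact: arcsine_weight_continuous.
Qed.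

(** Both sides are limits, by monotone convergence, of the integrals over
    matching exhaustions by compact intervals. *)
Lemma ge0_integral_arcsine_weight g : (forall x, 0 <= g x) -> continuous g ->
  (\int[mu]_(x in `]0%R, 1%R[) (g x / Num.sqrt (@wpoly R).[x])%:E =
   \int[mu]_(t in `[0%R, pi]) (g (xi t))%:E)%E.
Proof.
move=> g0 cg; have pi0 := pi_gt0 R.
pose a n : R := pi / n.+2%:R.
have a0 n : 0 < a n by rewrite divr_gt0.
have api n : a n <= pi - a n.
  have : a n <= pi / 2 by rewrite ler_pM2l // lef_pV2 ?posrE ?ltr0n // ler_nat.
  by lra.
have adecr m n : (m <= n)%N -> a n <= a m.
  by move=> mn; rewrite ler_pM2l // lef_pV2 ?posrE ?ltr0n // ler_nat !ltnS.
have cgx : continuous (g \o xi).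
  by move=> t; apply: continuous_comp; [exact: continuous_xi|exact: cg].
have mgx (D : set R) : measurable_fun D (fun t => (g (xi t))%:E).
  apply/measurable_EFinP; apply: measurable_funTS; apply: continuous_measurable_fun.
  exact: cgx.
have -> : (\int[mu]_(t in `[0%R, pi]) (g (xi t))%:E =
           \int[mu]_(t in `]0%R, pi[) (g (xi t))%:E)%E.
  by rewrite integral_itv_bndoo.
have nd1 : nondecreasing_seq (fun n => `[xi (pi - a n), xi (a n)]%classic).
  move=> m n mn; apply/subsetPset => x /=; rewrite !in_itv /= => /andP[h1 h2].
  have [am an] := (a0 m, a0 n); have [pm pn] := (api m, api n).
  have mnle := adecr _ _ mn.
  have e1 : xi (pi - a n) <= xi (pi - a m) by apply: xi_le; lra.
  have e2 : xi (a m) <= xi (a n) by apply: xi_le; lra.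
  by rewrite (le_trans e1 h1) (le_trans h2 e2).
have nd2 : nondecreasing_seq (fun n => `[a n, pi - a n]%classic).
  move=> m n mn; apply/subsetPset => x /=; rewrite !in_itv /= => /andP[h1 h2].
  by have mnle := adecr _ _ mn; apply/andP; split; lra.
rewrite -xi_image_exhausts -itv_pi_exhausts.
have mw n : measurable_fun `[xi (pi - a n), xi (a n)]
    (fun x => (g x / Num.sqrt (@wpoly R).[x])%:E).
  apply/measurable_EFinP; apply: subspace_continuous_measurable_fun => //.
  have bpi : pi - a n < pi by have := a0 n; lra.
  exact: (arcsine_weight_continuous (a0 n) (api n) bpi cg).
have C1 := @ge0_nondecreasing_set_cvg_integral _ (measurableTypeR R) R
  (fun n => `[xi (pi - a n), xi (a n)]%classic)
  (fun x => (g x / Num.sqrt (@wpoly R).[x])%:E) (@lebesgue_measure R) nd1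
  (fun n => measurable_itv _) mw.
have C2 := @ge0_nondecreasing_set_cvg_integral _ (measurableTypeR R) R
  (fun n => `[a n, pi - a n]%classic) (fun t => (g (xi t))%:E) (@lebesgue_measure R) nd2
  (fun n => measurable_itv _).
have {}C1 := cvg_lim (@ereal_hausdorff R) (C1 _).
have {}C2 := cvg_lim (@ereal_hausdorff R) (C2 _ _).
rewrite -C1; last by move=> n x _; rewrite lee_fin divr_ge0 // sqrtr_ge0.
rewrite -C2; [|by move=> n; exact: mgx|by move=> n x _; rewrite lee_fin].
apply: congr_lim; apply/funext => n.
by apply: integral_arcsine_weight => //; have := a0 n; lra.
Qed.

(** The integral of p against the arcsine weight, in the angular variable, in
    which it is an integral of a continuous function over a compact interval. *)
Definition cint p : R := \int[mu]_(t in `[0, pi]) p.[xi t].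

Lemma cint_is_linear : scalar cint.
Proof.
move=> k p r; rewrite /cint; under eq_Rintegral do rewrite hornerD hornerZ.
have ip := @itv_integrable _ 0 pi (@continuous_horner_xi p).
have ir := @itv_integrable _ 0 pi (@continuous_horner_xi r).
rewrite RintegralD ?RintegralZl //.
rewrite (_ : _ \o _ = EFin \o (fun t => (k *: p).[xi t])); last first.
  by apply/funext => t /=; rewrite hornerZ.
exact/itv_integrable/continuous_horner_xi.
Qed.

HB.instance Definition _ :=
  GRing.isLinear.Build R {poly R} R *%R cint cint_is_linear.

Lemma cintZ (k : R) p : cint (k *: p) = k * cint p.
Proof. exact: linearZ. Qed.

Lemma cintD p r : cint (p + r) = cint p + cint r.
Proof. exact: raddfD. Qed.

Lemma cintB p r : cint (p - r) = cint p - cint r.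
Proof. exact: raddfB. Qed.

Lemma cint_sum (I : Type) (s : seq I) (P : pred I) (F : I -> {poly R}) :
  cint (\sum_(i <- s | P i) F i) = \sum_(i <- s | P i) cint (F i).
Proof. exact: raddf_sum. Qed.

Lemma continuous_norm_horner_xi p : continuous (fun t => `|p.[xi t]|).
Proof.
move=> t; apply: (@continuous_comp _ _ _ (fun t => p.[xi t]) Num.norm).
  exact: continuous_horner_xi.
exact: norm_continuous.
Qed.

Lemma pnormE p : pnorm p = \int[mu]_(t in `[0, pi]) `|p.[xi t]|.
Proof.
rewrite /pnorm /Rintegral; congr fine.
apply: (@ge0_integral_arcsine_weight (fun x => `|p.[x]|)) => // x.
apply: (@continuous_comp _ _ _ (horner p) Num.norm); first exact: continuous_horner.
exact: norm_continuous.
Qed.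

Lemma pnorm_ge0 p : 0 <= pnorm p.
Proof. by rewrite pnormE; apply: Rintegral_ge0. Qed.

Lemma pnorm_le_cint p r : (forall t, `|p.[xi t]| <= r.[xi t]) -> pnorm p <= cint r.
Proof.
move=> pr; rewrite pnormE; apply: le_Rintegral => //; apply: itv_integrable.
  exact: continuous_norm_horner_xi.
exact: continuous_horner_xi.
Qed.

Lemma pnorm_nneg p : (forall t, 0 <= p.[xi t]) -> pnorm p = cint p.
Proof. by move=> p0; rewrite pnormE; apply: eq_Rintegral => t _; rewrite ger0_norm. Qed.

Lemma ler_pnormD p r : pnorm (p + r) <= pnorm p + pnorm r.
Proof.
have ip := @itv_integrable _ 0 pi (@continuous_norm_horner_xi p).
have ir := @itv_integrable _ 0 pi (@continuous_norm_horner_xi r).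
rewrite !pnormE -RintegralD //; apply: le_Rintegral => //.
- exact/itv_integrable/continuous_norm_horner_xi.
- apply: (@itv_integrable (fun t => `|p.[xi t]| + `|r.[xi t]|)) => t.
  by apply: cvgD; exact: continuous_norm_horner_xi.
- by move=> t _; rewrite hornerD ler_normD.
Qed.

Lemma norm_cintM_le p r : (forall t, `|r.[xi t]| <= 1) -> `|cint (p * r)| <= pnorm p.
Proof.
move=> r1; apply: le_trans (_ : \int[mu]_(t in `[0, pi]) `|(p * r).[xi t]| <= _).
  by apply: le_normr_Rintegral => //; exact/itv_integrable/continuous_horner_xi.
rewrite pnormE; apply: le_Rintegral => //.
- exact/itv_integrable/continuous_norm_horner_xi.
- exact/itv_integrable/continuous_norm_horner_xi.
- by move=> t _; rewrite hornerM normrM ler_piMr.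
Qed.

Lemma norm_chebT_le1 n t : `|(chebT n).[xi t]| <= 1.
Proof. by rewrite chebT_cos cos_max. Qed.

Lemma sin_natMpi n : sin (n%:R * pi : R) = 0.
Proof.
elim: n => [|n IH]; first by rewrite mul0r sin0.
by rewrite -natr1 mulrDl mul1r sinDpi IH oppr0.
Qed.

Lemma cint_chebT n : cint (chebT n) = if n == 0%N then pi else 0.
Proof.
rewrite /cint; have pi0 := pi_gt0 R.
case: n => [|n].
  under eq_Rintegral do rewrite /= hornerE.
  rewrite Rintegral_cst // mul1r.
  apply: (etrans (congr1 fine (@lebesgue_measure_itv R `[0, pi]))).
  by rewrite /= lte_fin pi0 /= subr0.
under eq_Rintegral do rewrite chebT_cos.
pose F (t : R) := sin (n.+1%:R * t) / n.+1%:R.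
have dF (t : R) : is_derive t 1 F (cos (n.+1%:R * t)).
  rewrite /F (_ : (fun _ => _) = (fun t : R => n.+1%:R^-1 * (sin \o ( *%R n.+1%:R)) t)); last first.
    by apply/funext => s; rewrite mulrC.
  apply: is_derive_eq.
  rewrite /GRing.scale /= !(mulr0, addr0, add0r, mulr1).
  by field; rewrite ?natr1 ?nat1r pnatr_eq0.
have cF : continuous F.
  by move=> t; apply/differentiable_continuous/derivable1_diffP.
rewrite /Rintegral (@continuous_FTC2 _ _ F) //.
- by rewrite /F mulr0 sin0 sin_natMpi mul0r -EFinB subrr.
- apply: continuous_subspaceT => t; apply: continuous_comp; last exact: continuous_cos.
  by apply: cvgM; [exact: cvg_cst|exact: cvg_id].
- split; [by move=> t _|by apply: cvg_at_right_filter; exact: cF|].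
  by apply: cvg_at_left_filter; exact: cF.
- by move=> t _; rewrite derive1E derive_val.
Qed.

End CosineSubstitution.

(** * Chebyshev products and orthogonality *)

Section ChebyshevProducts.
Context {R : realType}.
Implicit Types (p r : {poly R}) (i j k n : nat).
Notation T := (@chebT R).
Notation U := (@chebU R).
Notation w := (@wpoly R).

(** A nonzero polynomial cannot vanish at the infinitely many points
    xi (pi / k).  This reduces the product formulas to trigonometric addition
    formulas. *)
Lemma poly_xi_ext p r :
  (forall t, 0 < t < pi -> p.[xi t] = r.[xi t]) -> p = r.
Proof.
move=> pr; apply/eqP; rewrite -subr_eq0; apply/negPn/negP => pr0.
pose tk (k : nat) : R := pi / k.+2%:R.
have tkP k : 0 < tk k < pi.
  by rewrite divr_gt0 ?pi_gt0 //= ltr_pdivrMr // ltr_pMr ?pi_gt0 // ltr1n.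
have : (size [seq xi (tk k) | k <- iota 0 (size (p - r)%R)] < size (p - r)%R)%N.
  apply: max_poly_roots => //.
    by apply/allP => x /mapP[k _ ->]; rewrite rootE hornerD hornerN pr // subrr.
  rewrite map_inj_uniq ?iota_uniq // => k l.
  move=> /(mulIf (_ : 2^-1 != 0 :> R)); rewrite invr_eq0 pnatr_eq0 => /(_ isT) /addIr.
  have in0pi m : tk m \in `[0, pi] by rewrite in_itv /=; case/andP: (tkP m) => /ltW -> /ltW ->.
  move=> /(cos_inj (in0pi k) (in0pi l)) /(mulfI (lt0r_neq0 (pi_gt0 R))) /invr_inj /eqP.
  by rewrite eqr_nat => /eqP[].
by rewrite size_map size_iota ltnn.
Qed.

Lemma chebU_xi n t : (U n).[xi t] * sin t = 2 * sin (n%:R * t).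
Proof. exact: chebU_sin. Qed.

Lemma chebU_xiE n t : 0 < t < pi -> (U n).[xi t] = 2 * sin (n%:R * t) / sin t.
Proof. by move=> /sin_gt0_pi s0; rewrite -chebU_xi mulfK ?gt_eqF. Qed.

Let natMD i j (t : R) : (i + j)%:R * t = i%:R * t + j%:R * t.
Proof. by rewrite natrD mulrDl. Qed.

Let natMB i j (ji : (j <= i)%N) (t : R) : (i - j)%:R * t = i%:R * t - j%:R * t.
Proof. by rewrite natrB // mulrBl. Qed.

Lemma chebTM i j : (j <= i)%N -> T i * T j = 2^-1 *: (T (i + j) + T (i - j)).
Proof.
move=> ji; apply: poly_xi_ext => t _.
rewrite !hornerE !chebT_cos (natMD _ _ t) (natMB ji t)
  (cosD (i%:R * t) (j%:R * t)) (cosB (i%:R * t)).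
by field.
Qed.

Lemma chebUMw i j : (j <= i)%N -> U i * U j * w = 2^-1 *: (T (i - j) - T (i + j)).
Proof.
move=> ji; apply: poly_xi_ext => t tpi.
rewrite hornerM horner_wpoly_xi !hornerE !chebT_cos (natMD _ _ t) (natMB ji t)
  (cosD (i%:R * t) (j%:R * t)) (cosB (i%:R * t)).
rewrite !chebU_xiE //; have s0 := sin_gt0_pi tpi.
by rewrite /=; field; rewrite gt_eqF.
Qed.

Lemma chebUTM i j : (j <= i)%N -> U i * T j = 2^-1 *: (U (i + j) + U (i - j)).
Proof.
move=> ji; apply: poly_xi_ext => t tpi.
rewrite !hornerE !chebU_xiE // !chebT_cos (natMD _ _ t) (natMB ji t)
  (sinD (i%:R * t) (j%:R * t)) (sinB (i%:R * t)).
have s0 := sin_gt0_pi tpi.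
by rewrite /=; field; rewrite gt_eqF.
Qed.

Lemma chebTUM i j : (j <= i)%N -> T i * U j = 2^-1 *: (U (i + j) - U (i - j)).
Proof.
move=> ji; apply: poly_xi_ext => t tpi.
rewrite !hornerE !chebU_xiE // !chebT_cos (natMD _ _ t) (natMB ji t)
  (sinD (i%:R * t) (j%:R * t)) (sinB (i%:R * t)).
have s0 := sin_gt0_pi tpi.
by rewrite /=; field; rewrite gt_eqF.
Qed.

Lemma size_chebU_le n : (size (U n) <= n)%N.
Proof. by case: n => [|n]; rewrite ?size_chebU // size_poly0. Qed.

(** By the product formula, p times T_k has no component on T_0. *)
Lemma cintM_chebT_eq0 p k : (size p <= k)%N -> cint (p * T k) = 0.
Proof.
case: k => [|k] pk.
  have -> : p = 0 by apply/eqP; rewrite -size_poly_leq0.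
  by rewrite mul0r raddf0.
rewrite (chebT_coefE pk) mulr_suml cint_sum big_nat big1 // => i /andP[_ ik].
rewrite -scalerAl (mulrC (T i)) chebTM ?(ltnW ik) // scalerA cintZ cintD !cint_chebT.
by rewrite addSn subn_eq0 leqNgt ik /= addr0 mulr0.
Qed.

(** As U_1 is constant, U_k w is a combination of T_(k-1) and T_(k+1). *)
Lemma cintM_chebUw_eq0 p k : (size p < k)%N -> cint (p * U k * w) = 0.
Proof.
case: k => [//|k] pk.
have -> : p * U k.+1 * w = 2^-1 *: (p * (U k.+1 * U 1 * w)).
  rewrite [U 1]/(2%:P) -mul_polyC; move: (U k.+1) => u.
  have E (x y : {poly R}) : y * (p * (u * x * w)) = y * x * (p * u * w) by ring.
  by rewrite E -polyCM mulVf ?pnatr_eq0 // mul1r.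
rewrite chebUMw // -scalerAr mulrBr !cintZ cintB !cintM_chebT_eq0.
- by rewrite subrr !mulr0.
- by rewrite addn1 leqW // ltnW.
- by rewrite subn1 -ltnS.
Qed.

End ChebyshevProducts.

(** * The norm of quadruplets *)

Section QuadrupletNorm.
Context {R : realType}.
Implicit Types (q r e : quad R) (p : {poly R}).
Notation w := (@wpoly R).

(** The polar form of M, that is, the pointwise Euclidean scalar product of the
    vectors (a, b sqrt w, c, d sqrt w). *)
Definition qdot q r : {poly R} :=
  let: (a, b, c, d) := q in let: (a', b', c', d') := r in
  a * a' + b * b' * w + c * c' + d * d' * w.

Lemma MqD q r : Mq (q + r) = Mq q + qdot q r *+ 2 + Mq r.
Proof.
case: q r => [[[a b] c] d] [[[a' b'] c'] d'].
rewrite -[_ + _ in LHS]/(a + a', b + b', c + c', d + d') /Mq /qdot; ring.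
Qed.

Lemma MqZ (k : R) q : Mq (k *: q) = k ^+ 2 *: Mq q.
Proof.
case: q => [[[a b] c] d].
rewrite -[_ *: _ in LHS]/(k *: a, k *: b, k *: c, k *: d) /Mq -!mul_polyC expr2 polyCM; ring.
Qed.

Lemma MqN q : Mq (- q) = Mq q.
Proof. by rewrite -scaleN1r MqZ sqrrN expr1n scale1r. Qed.

Lemma subr_Mq q r : Mq q - Mq r = qdot (q - r) (q + r).
Proof.
case: q r => [[[a b] c] d] [[[a' b'] c'] d'].
rewrite -[X in qdot _ X]/(a + a', b + b', c + c', d + d').
rewrite -[X in qdot X _]/(a - a', b - b', c - c', d - d') /Mq /qdot; ring.
Qed.

Lemma Mq_ge0 q t : 0 <= (Mq q).[xi t].
Proof.
case: q => [[[a b] c] d]; rewrite /Mq !(horner_wpoly_xi, hornerD, horner_exp, hornerM).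
by rewrite -!exprMn !addr_ge0 ?sqr_ge0.
Qed.

Lemma pnorm_Mq q : pnorm (Mq q) = cint (Mq q).
Proof. by apply: pnorm_nneg => t; exact: Mq_ge0. Qed.

Lemma qnorm_ge0 q : 0 <= qnorm q.
Proof. exact: sqrtr_ge0. Qed.

Lemma qnorm_sqr q : qnorm q ^+ 2 = cint (Mq q).
Proof. by rewrite sqr_sqrtr ?pnorm_Mq // -pnorm_Mq pnorm_ge0. Qed.

Lemma qnormN q : qnorm (- q) = qnorm q.
Proof. by rewrite /qnorm MqN. Qed.

(** The infimum over s of the right-hand side is a b.  It need not be attained
    when a or b vanishes, whence the perturbation of both by e in the proof. *)
Lemma le_mul_of_amgm (x a b : R) : 0 <= a -> 0 <= b ->
  (forall s, 0 < s -> x <= (s * a ^+ 2 + s^-1 * b ^+ 2) / 2) -> x <= a * b.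
Proof.
move=> a0 b0 H.
have step (e : R) : 0 < e -> x <= (a + e) * (b + e).
  move=> e0; have ae : 0 < a + e by lra.
  have be : 0 < b + e by lra.
  have s0 : 0 < (b + e) / (a + e) by rewrite divr_gt0.
  apply: (le_trans (H _ s0)); rewrite invf_div.
  have -> : (a + e) * (b + e) =
      ((b + e) / (a + e) * (a + e) ^+ 2 + (a + e) / (b + e) * (b + e) ^+ 2) / 2.
    by field; rewrite !gt_eqF.
  rewrite ler_pM2r ?invr_gt0 // lerD // ler_wpM2l ?divr_ge0 ?(ltW ae) ?(ltW be) //;
    by rewrite lerXn2r ?nnegrE; lra.
apply/ler_addgt0Pr => e e0.
pose f := Num.min 1 (e / (a + b + 1)).
have k0 : 0 < a + b + 1 by lra.
have f0 : 0 < f by rewrite lt_min ltr01 divr_gt0.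
have f1 : f <= 1 by rewrite ge_min lexx.
have fe : f * (a + b + 1) <= e.
  by rewrite -ler_pdivlMr // ge_min lexx orbT.
apply: (le_trans (step _ f0)).
have : f * f <= f by rewrite ler_piMr // ltW.
by lra.
Qed.

(** Cauchy-Schwarz, from the pointwise inequality
    |u v| <= (s u^2 + v^2 / s) / 2, optimized in s after integration. *)
Lemma pnorm_qdot_le q r : pnorm (qdot q r) <= qnorm q * qnorm r.
Proof.
apply: le_mul_of_amgm; rewrite ?qnorm_ge0 // => s s0.
rewrite !qnorm_sqr.
have -> : (s * cint (Mq q) + s^-1 * cint (Mq r)) / 2 =
    cint ((s / 2) *: Mq q + (s^-1 / 2) *: Mq r).
  by rewrite cintD !cintZ; ring.
apply: pnorm_le_cint => t.
case: q r => [[[a b] c] d] [[[a' b'] c'] d'].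
rewrite /Mq /qdot !(horner_wpoly_xi, hornerZ, hornerD, horner_exp, hornerM).
set y := sin t / 2.
have sq (u v : R) : `|u * v| <= s / 2 * u ^+ 2 + s^-1 / 2 * v ^+ 2.
  have h : 0 <= s^-1 / 2 * (s * u - v) ^+ 2 by rewrite mulr_ge0 ?sqr_ge0 // divr_ge0 // invr_ge0 ltW.
  have h' : 0 <= s^-1 / 2 * (s * u + v) ^+ 2 by rewrite mulr_ge0 ?sqr_ge0 // divr_ge0 // invr_ge0 ltW.
  have E : s^-1 / 2 * (s * u - v) ^+ 2 = s / 2 * u ^+ 2 + s^-1 / 2 * v ^+ 2 - u * v.
    by field; rewrite gt_eqF.
  have E' : s^-1 / 2 * (s * u + v) ^+ 2 = s / 2 * u ^+ 2 + s^-1 / 2 * v ^+ 2 + u * v.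
    by field; rewrite gt_eqF.
  by rewrite ler_norml; apply/andP; split; lra.
have e1 := sq a.[xi t] a'.[xi t]; have e2 := sq (b.[xi t] * y) (b'.[xi t] * y).
have e3 := sq c.[xi t] c'.[xi t]; have e4 := sq (d.[xi t] * y) (d'.[xi t] * y).
apply: (le_trans _ (le_trans (lerD (lerD (lerD e1 e2) e3) e4) _)).
  rewrite (_ : _ + _ = a.[xi t] * a'.[xi t] + b.[xi t] * y * (b'.[xi t] * y) +
    c.[xi t] * c'.[xi t] + d.[xi t] * y * (d'.[xi t] * y)); last by ring.
  apply: le_trans (ler_normD _ _) _; rewrite lerD2r.
  apply: le_trans (ler_normD _ _) _; rewrite lerD2r.
  exact: ler_normD.
by rewrite le_eqVlt; apply/orP; left; apply/eqP; ring.
Qed.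

Lemma ler_qnormD q r : qnorm (q + r) <= qnorm q + qnorm r.
Proof.
rewrite -(@ler_pXn2r _ 2) // ?nnegrE ?addr_ge0 ?qnorm_ge0 //.
have h : cint (qdot q r) <= qnorm q * qnorm r; last first.
  by rewrite qnorm_sqr MqD mulr2n !cintD -!qnorm_sqr sqrrD mulr2n lerD2r lerD2l lerD.
apply: le_trans (pnorm_qdot_le q r); apply: le_trans (ler_norm _) _.
rewrite -[X in cint X]mulr1; apply: norm_cintM_le => t.
by rewrite hornerE normr1.
Qed.

Lemma pnorm_sub_Mq_le q r : pnorm (Mq q - Mq r) <= qnorm (q - r) * (qnorm q + qnorm r).
Proof.
rewrite subr_Mq (le_trans (pnorm_qdot_le _ _)) // ler_wpM2l ?qnorm_ge0 //.
exact: ler_qnormD.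
Qed.

Lemma Mq_qmul e q : Mq (qmul e q) = Mq e * Mq q.
Proof.
case: e q => [[[a b] c] d] [[[a' b'] c'] d'].
by rewrite /qmul /Mq; ring.
Qed.

Lemma Mq_qconj q : Mq (qconj q) = Mq q.
Proof. by case: q => [[[a b] c] d]; rewrite /qconj /Mq !sqrrN. Qed.

Lemma qmul_qconjl q : qmul (qconj q) q = (Mq q, 0, 0, 0).
Proof.
case: q => [[[a b] c] d]; rewrite /qconj /qmul /Mq.
by congr (_, _, _, _); ring.
Qed.

Lemma qmul1l q : qmul qone q = q.
Proof.
case: q => [[[a b] c] d]; rewrite /qone /qmul.
by congr (_, _, _, _); ring.
Qed.

Lemma qmul_qconjK e q : Mq e = 1 -> qmul (qconj e) (qmul e q) = q.
Proof. by move=> M1; rewrite qmulA qmul_qconjl M1 qmul1l. Qed.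

Lemma qmulBr e q r : qmul e (q - r) = qmul e q - qmul e r.
Proof.
case: e q r => [[[x y] z] v] [[[a b] c] d] [[[a' b'] c'] d'].
rewrite -[_ - _ in LHS]/(a - a', b - b', c - c', d - d').
rewrite /qmul -[_ - _ in RHS]/(_ - _, _ - _, _ - _, _ - _).
by congr (_, _, _, _) => /=; ring.
Qed.

Lemma qnorm_qmul e q : Mq e = 1 -> qnorm (qmul e q) = qnorm q.
Proof. by move=> M1; rewrite /qnorm Mq_qmul M1 mul1r. Qed.

End QuadrupletNorm.

(** * Minimizers of the inverse form of a pencil *)

Section PencilMinimizer.
Context {R : realType}.
Implicit Types (N : nat).

Definition bform N (A : 'M[R]_N) (X Y : 'cV[R]_N) : R := (X^T *m A *m Y) 0 0.

Lemma bformDl N A (X Y Z : 'cV[R]_N) : bform A (X + Y) Z = bform A X Z + bform A Y Z.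
Proof. by rewrite /bform linearD /= !mulmxDl mxE. Qed.

Lemma bformDr N A (X Y Z : 'cV[R]_N) : bform A X (Y + Z) = bform A X Y + bform A X Z.
Proof. by rewrite /bform !mulmxDr mxE. Qed.

Lemma bformNl N A (X Y : 'cV[R]_N) : bform A (- X) Y = - bform A X Y.
Proof. by rewrite /bform linearN /= !mulNmx mxE. Qed.

Lemma bformNr N A (X Y : 'cV[R]_N) : bform A X (- Y) = - bform A X Y.
Proof. by rewrite /bform !mulmxN mxE. Qed.

Lemma bformDm N A B (X Y : 'cV[R]_N) : bform (A + B) X Y = bform A X Y + bform B X Y.
Proof. by rewrite /bform mulmxDr mulmxDl mxE. Qed.

Lemma bformZm N (k : R) A (X Y : 'cV[R]_N) : bform (k *: A) X Y = k * bform A X Y.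
Proof. by rewrite /bform -scalemxAr -scalemxAl mxE. Qed.

Lemma bformZl N A (k : R) (X Y : 'cV[R]_N) : bform A (k *: X) Y = k * bform A X Y.
Proof. by rewrite /bform linearZ /= -!scalemxAl mxE. Qed.

Lemma bformZr N A (k : R) (X Y : 'cV[R]_N) : bform A X (k *: Y) = k * bform A X Y.
Proof. by rewrite /bform -!scalemxAr mxE. Qed.

Lemma bformC N A (X Y : 'cV[R]_N) : A^T = A -> bform A X Y = bform A Y X.
Proof.
move=> sA; rewrite /bform; transitivity ((X^T *m A *m Y)^T 0 0).
  by rewrite [RHS]mxE.
by rewrite !trmx_mul trmxK sA mulmxA.
Qed.

Lemma bform_mulr N A B (X Y : 'cV[R]_N) : bform A X (B *m Y) = bform (A *m B) X Y.
Proof. by rewrite /bform !mulmxA. Qed.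

Lemma posdef_unitmx N (A : 'M[R]_N) : posdef A -> A \in unitmx.
Proof.
move=> pA; rewrite -row_free_unit -kermx_eq0; apply/negPn/negP => /rowV0Pn[v].
move=> /sub_kermxP vA v0; have := pA v^T.
rewrite trmxK vA mul0mx mxE ltxx => H; suff: false by [].
by apply: H; apply: contra_neq v0 => /(congr1 trmx); rewrite trmxK trmx0.
Qed.

Lemma posdef_ge0 N (A : 'M[R]_N) (v : 'cV[R]_N) : posdef A -> 0 <= bform A v v.
Proof.
move=> pA; have [->|v0] := eqVneq v 0; last exact/ltW/pA.
by rewrite /bform mulmx0 mxE.
Qed.

Lemma horner0_le0 (p : {poly R}) (d : R) : 0 < d ->
  (forall t, 0 < t < d -> p.[t] <= 0) -> p.[0] <= 0.
Proof.
move=> d0 H; rewrite leNgt; apply/negP => p0.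
have cp : {for 0, continuous (horner p)} by exact: continuous_horner.
have /nbhs_ballP[e /= e0 He] : \forall t \near (0 : R), 0 < p.[t] by exact: (cvgr_gt _ cp).
pose s := Num.min (d / 2) (e / 2).
have s0 : 0 < s by rewrite lt_min !divr_gt0.
have sd : s < d by rewrite gt_min (_ : d / 2 < d) // ltr_pdivrMr // ltr_pMr // ltr1n.
have se : s < e by rewrite gt_min (_ : e / 2 < e) ?orbT // ltr_pdivrMr // ltr_pMr // ltr1n.
have : 0 < p.[s] by apply: He; rewrite /ball /= sub0r normrN gtr0_norm.
by apply/negP; rewrite -leNgt H // s0.
Qed.

Lemma poly_sign_change_root (p : {poly R}) (d : R) : 0 < d ->
  (forall t, `|t| < d -> t * p.[t] <= 0) -> p.[0] = 0.
Proof.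
move=> d0 H; apply/eqP; rewrite eq_le; apply/andP; split.
  apply: (horner0_le0 d0) => t /andP[t0 td].
  by have := H t; rewrite gtr0_norm // => /(_ td); rewrite pmulr_rle0.
have : (- (p \Po - 'X)).[0] <= 0.
  apply: (horner0_le0 d0) => t /andP[t0 td].
  have := H (- t); rewrite normrN gtr0_norm // => /(_ td).
  by rewrite mulNr -mulrN pmulr_rle0 // hornerN horner_comp !hornerE.
by rewrite hornerN horner_comp !hornerE oppr0 oppr_le0.
Qed.

(** Replacing the inverse by the adjugate makes the form a polynomial in t; this
    is what replaces differentiability of the matrix inverse. *)
Lemma adj_line_poly N (M A : 'M[R]_N) (X : 'cV[R]_N) : exists p : {poly R},
  forall t, p.[t] = bform A (\adj (M + t *: A) *m X) (\adj (M + t *: A) *m X).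
Proof.
pose Mp : 'M[{poly R}]_N := map_mx polyC M + 'X *: map_mx polyC A.
pose Yp := \adj Mp *m map_mx polyC X.
exists ((Yp^T *m map_mx polyC A *m Yp) 0 0) => t.
have hC n m (B : 'M[R]_(n, m)) : map_mx (horner_eval t) (map_mx polyC B) = B.
  by rewrite -map_mx_comp map_mx_id // => x /=; rewrite /horner_eval hornerC.
have EM : map_mx (horner_eval t) Mp = M + t *: A.
  by rewrite map_mxD map_mxZ !hC /= /horner_eval hornerX.
have EY : map_mx (horner_eval t) Yp = \adj (M + t *: A) *m X.
  by rewrite map_mxM map_mx_adj EM hC.
transitivity (map_mx (horner_eval t) (Yp^T *m map_mx polyC A *m Yp) 0 0).
  by rewrite [RHS]mxE.
by rewrite !map_mxM -map_trmx EY map_mx_adj !hC EM.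
Qed.

(** With M(t) = M + t A and Z(t) = M(t)^-1 X, nonnegativity of the square of
    Z - Y in the metric M gives G(t) <= G(0) - t Z^t A Z.  As G(0) is minimal,
    t Z^t A Z <= 0, so Z^t A Z changes sign at t = 0; multiplied by the square
    of det M(t) it is a polynomial in t, which therefore vanishes there. *)
Lemma line_minimizer_stationary N (M A : 'M[R]_N) (X : 'cV[R]_N) (d : R) :
  M^T = M -> A^T = A -> 0 < d ->
  (forall t, `|t| < d -> posdef (M + t *: A)) ->
  (forall t, `|t| < d ->
     bform (invmx M) X X <= bform (invmx (M + t *: A)) X X) ->
  bform A (invmx M *m X) (invmx M *m X) = 0.
Proof.
move=> sM sA d0 pd mini.
have pM : posdef M by have := pd 0; rewrite normr0 scale0r addr0; exact.
have uM := posdef_unitmx pM.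
have [p pE] := adj_line_poly M A X.
have pE' t : `|t| < d -> p.[t] = \det (M + t *: A) ^+ 2 *
    bform A (invmx (M + t *: A) *m X) (invmx (M + t *: A) *m X).
  move=> td; have ut := posdef_unitmx (pd t td).
  have ud : \det (M + t *: A) != 0 by move: ut; rewrite unitmxE unitfE.
  have -> : invmx (M + t *: A) = (\det (M + t *: A))^-1 *: \adj (M + t *: A).
    by rewrite /invmx ut.
  rewrite pE -scalemxAl bformZl bformZr; move: (bform _ _ _) => b.
  by field.
suff : p.[0] = 0.
  rewrite pE' ?normr0 // scale0r addr0 => /eqP; rewrite mulf_eq0 => /orP[|/eqP//].
  by rewrite expf_eq0 /=; move: uM; rewrite unitmxE unitfE => /negPf ->.
apply: poly_sign_change_root d0 _ => t td.
rewrite pE' // mulrCA mulr_ge0_le0 ?sqr_ge0 //.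
have ut := posdef_unitmx (pd t td).
set Y := invmx M *m X; set Z := invmx _ *m X.
have MY : M *m Y = X by rewrite mulKVmx.
have MZ : (M + t *: A) *m Z = X by rewrite mulKVmx.
have G1 : bform (invmx M) X X = bform 1%:M X Y.
  by rewrite bform_mulr mul1mx.
have G2 : bform (invmx (M + t *: A)) X X = bform 1%:M X Z.
  by rewrite bform_mulr mul1mx.
have := mini t td; rewrite G1 G2 => le1.
(* the nonnegative square of Z - Y in the metric M *)
have := posdef_ge0 (Z - Y) pM.
rewrite bformDl !bformDr !bformNl !bformNr opprK.
have EY V : bform M V Y = bform 1%:M X V.
  by rewrite [RHS]bformC ?trmx1 // -MY bform_mulr mul1mx.
have EYZ : bform M Y Z = bform 1%:M X Z by rewrite bformC.
have EZZ : bform M Z Z = bform 1%:M X Z - t * bform A Z Z.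
  have : bform (M + t *: A) Z Z = bform 1%:M X Z.
    by rewrite [RHS]bformC ?trmx1 // -MZ bform_mulr mul1mx.
  by rewrite bformDm bformZm => <-; rewrite addrK.
by rewrite !EY EYZ EZZ; lra.
Qed.

(** Both claims follow by expanding X = Y + W Y: the cross term Y^t W Y vanishes,
    and positivity of 1 + W at W Y bounds the cubic term Y^t W^3 Y from below
    by - |W Y|^2. *)
Lemma correction_estimate N (W : 'M[R]_N) (Y : 'cV[R]_N) :
  W^T = W -> posdef (1%:M + W) -> bform W Y Y = 0 ->
  let X := Y + W *m Y in
  bform 1%:M Y Y <= bform 1%:M X X /\
  bform 1%:M (X - Y) (X - Y) <= bform W X X.
Proof.
move=> sW pW WY0 X.
have e1 : bform 1%:M Y (W *m Y) = 0 by rewrite bform_mulr mul1mx.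
have e2 : bform 1%:M (W *m Y) Y = 0 by rewrite bformC ?trmx1.
have p1 : 0 <= bform 1%:M (W *m Y) (W *m Y).
  have := posdef_ge0 (W *m Y) (_ : posdef 1%:M); apply => v v0.
  rewrite mulmx1 mxE (eq_bigr (fun i => v i 0 ^+ 2)); last by move=> i _; rewrite mxE expr2.
  rewrite lt0r sumr_ge0 ?andbT; last by move=> i _; rewrite sqr_ge0.
  apply: contra_neq v0 => /eqP; rewrite psumr_eq0 => [/allP h|i _]; last by rewrite sqr_ge0.
  apply/colP => i; rewrite mxE; apply/eqP; rewrite -sqrf_eq0.
  by have := h i; rewrite mem_index_enum => /(_ isT).
split.
  by rewrite /X bformDl !bformDr e1 e2; lra.
rewrite /X addrAC subrr add0r bformDl !bformDr WY0.
have h1 : bform W Y (W *m Y) = bform 1%:M (W *m Y) (W *m Y).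
  by rewrite [LHS]bformC // bform_mulr mul1mx.
have h2 : bform W (W *m Y) Y = bform 1%:M (W *m Y) (W *m Y).
  by rewrite bform_mulr mul1mx.
have := posdef_ge0 (W *m Y) pW; rewrite bformDm h1 h2; lra.
Qed.

Lemma bformE N A (X Y : 'cV[R]_N) :
  bform A X Y = \sum_j (\sum_i X i 0 * A i j) * Y j 0.
Proof.
rewrite /bform mxE; apply: eq_bigr => j _; congr (_ * _).
by rewrite mxE; apply: eq_bigr => i _; rewrite mxE.
Qed.

Lemma cvg_coord N (Xs : nat -> 'cV[R]_N) (X : 'cV[R]_N) i :
  Xs @ \oo --> X -> (fun k => Xs k i 0) @ \oo --> X i 0.
Proof.
move=> cX; exact: (@cvg_comp _ _ _ Xs (fun M : 'cV[R]_N => M i 0) _ _ _ cX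
  (@coord_continuous R N 1 i 0 X)).
Qed.

Lemma cvg_bform N A (Xs Ys : nat -> 'cV[R]_N) (X Y : 'cV[R]_N) :
  Xs @ \oo --> X -> Ys @ \oo --> Y ->
  (fun k => bform A (Xs k) (Ys k)) @ \oo --> bform A X Y.
Proof.
move=> cX cY; rewrite bformE; under eq_cvg do rewrite bformE.
apply: cvg_big => [|j _]; first exact: add_continuous.
apply: cvgM; last exact: cvg_coord.
apply: cvg_big => [|i _]; first exact: add_continuous.
by apply: cvgM; [exact: cvg_coord|exact: cvg_cst].
Qed.

(** A closed condition on (X, Y) satisfied by a corrected vector Y of X, so that
    it survives the passage to the limit outside the generic set. *)
Definition corrected N (A B : 'M[R]_N) (X Y : 'cV[R]_N) : Prop :=
  [/\ bform A Y Y = 0, bform B Y Y = 0, bform 1%:M Y Y <= bform 1%:M X X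
    & bform 1%:M (X - Y) (X - Y) <= `|bform A X X| + 2 * `|bform B X X|].

Lemma trmx_pencil N (A B : 'M[R]_N) l u : A^T = A -> B^T = B ->
  (pencil A B l u)^T = pencil A B l u.
Proof. by move=> sA sB; rewrite /pencil !linearD !linearZ /= sA sB trmx1. Qed.

(* The bounds 1 and 2 on |l| and |m| are crude but common to both pencils. *)
Section Corrected.
Variables (N : nat) (A B : 'M[R]_N).
Hypotheses (sA : A^T = A) (sB : B^T = B) (opD : open (pencil_dom A B)).
Hypothesis bdD : forall z, pencil_dom A B z -> `|z.1| <= 1 /\ `|z.2| <= 2.

Lemma corrected_minimizer X z : pencil_dom A B z ->
  (forall z', pencil_dom A B z' ->
     pencil_form A B X z.1 z.2 <= pencil_form A B X z'.1 z'.2) ->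
  corrected A B X (invmx (pencil A B z.1 z.2) *m X).
Proof.
move=> Dz mini; set Y := _ *m X; set M := pencil A B z.1 z.2.
have sM : M^T = M by exact: trmx_pencil.
have /nbhs_ballP[d /= d0 Hd] : nbhs z (pencil_dom A B) by exact: open_nbhs_nbhs.
have dA t : `|t| < d -> pencil_dom A B (z.1 + t, z.2).
  move=> td; apply: Hd; split; rewrite /ball /= ?subrr ?normr0 //.
  by rewrite opprD addrA subrr sub0r normrN.
have dB t : `|t| < d -> pencil_dom A B (z.1, z.2 + t).
  move=> td; apply: Hd; split; rewrite /ball /= ?subrr ?normr0 //.
  by rewrite opprD addrA subrr sub0r normrN.
have EA t : M + t *: A = pencil A B (z.1 + t) z.2.
  by rewrite /M /pencil scalerDl -!addrA; do 2 congr (_ + _); rewrite addrC.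
have EB t : M + t *: B = pencil A B z.1 (z.2 + t).
  by rewrite /M /pencil scalerDl addrA.
have YA : bform A Y Y = 0.
  apply: (line_minimizer_stationary sM sA d0) => t td.
    by rewrite EA; exact: (dA t td).
  by rewrite EA; exact: (mini _ (dA t td)).
have YB : bform B Y Y = 0.
  apply: (line_minimizer_stationary sM sB d0) => t td.
    by rewrite EB; exact: (dB t td).
  by rewrite EB; exact: (mini _ (dB t td)).
pose W := z.1 *: A + z.2 *: B.
have sW : W^T = W by rewrite /W linearD !linearZ /= sA sB.
have EM : M = 1%:M + W by rewrite /M /pencil addrA.
have pW : posdef (1%:M + W) by rewrite -EM.
have WY : bform W Y Y = 0 by rewrite bformDm !bformZm YA YB !mulr0 addr0.
have XE : X = Y + W *m Y.
  by rewrite -[Y in Y + _]mul1mx -mulmxDl -EM /Y mulKVmx // posdef_unitmx.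
have [] := correction_estimate sW pW WY; rewrite -XE => h1 h2; split=> //.
apply: (le_trans h2); rewrite bformDm !bformZm.
have [z1 z2] := bdD Dz.
apply: (le_trans (ler_norm _)); apply: (le_trans (ler_normD _ _)).
by rewrite !normrM lerD // ?ler_piMl // ler_wpM2r.
Qed.

Lemma correctedP (S : set 'cV[R]_N) chi X :
  correction_map A B S chi -> corrected A B X (chi X).
Proof.
move=> [onS offS]; have good Z : S Z -> corrected A B Z (chi Z).
  by move=> /onS[z [Dz mini ->]]; exact: corrected_minimizer.
have [/good//|/offS[Xs [SXs cX cY]]] := pselect (S X).
have cAY := cvg_bform (A := A) cY cY; have cBY := cvg_bform (A := B) cY cY.
have cYY := cvg_bform (A := 1%:M) cY cY; have cXX := cvg_bform (A := 1%:M) cX cX.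
have cXY := cvg_bform (A := 1%:M) cX cY.
have cAX := cvg_bform (A := A) cX cX; have cBX := cvg_bform (A := B) cX cX.
have E Z V : bform 1%:M (Z - V) (Z - V) =
    bform 1%:M Z Z - 2 * bform 1%:M Z V + bform 1%:M V V :> R.
  rewrite bformDl !bformDr !bformNl !bformNr (bformC V Z) ?trmx1 //; ring.
have zero (u : nat -> R) l : (forall k, u k = 0) -> u @ \oo --> l -> l = 0.
  move=> /funext -> cl; apply: (norm_cvg_unique cl); exact: cvg_cst.
split.
- by apply: (zero _ _ _ cAY) => k; have [] := good _ (SXs k).
- by apply: (zero _ _ _ cBY) => k; have [] := good _ (SXs k).
- by apply: (ler_cvg_to cYY cXX); apply: nearW => k; have [] := good _ (SXs k).
- rewrite E.
  have cl := cvgD (cvgB cXX (cvgM (cvg_cst (2 : R)) cXY)) cYY.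
  have cr := cvgD (cvg_norm cAX) (cvgM (cvg_cst (2 : R)) (cvg_norm cBX)).
  apply: (ler_cvg_to (cl _ _ _ _) (cr _ _ _ _ _)); apply: nearW => k.
  by have [_ _ _] := good _ (SXs k); rewrite E.
Qed.

End Corrected.

End PencilMinimizer.

(** * The two correction pencils *)

Section CorrectionPencils.
Context {R : realType}.

Lemma diag4_tr m n (P : 'M[R]_m) (Q : 'M[R]_n) : P^T = P -> Q^T = Q ->
  (diag4 P Q)^T = diag4 P Q.
Proof. by move=> sP sQ; rewrite /diag4 !tr_block_mx !trmx0 sP sQ. Qed.

Lemma trmx_Smx : (@Smx R)^T = Smx.
Proof. by rewrite /Smx trmx_delta. Qed.

Lemma trmx_Tmx : (@Tmx R)^T = Tmx.
Proof. by rewrite /Tmx linearD /= !trmx_delta addrC. Qed.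

Lemma trmxN N (P : 'M[R]_N) : P^T = P -> (- P)^T = - P.
Proof. by move=> sP; rewrite linearN /= sP. Qed.

Lemma open_pencil_dom8 : open (pencil_dom (@A8 R) B8).
Proof.
rewrite pencil_dom8E.
rewrite (_ : mkset _ = (fun z : R * R => `|z.1| + z.2 ^+ 2) @^-1` [set x | x < 1]) //.
apply: open_comp; last exact: open_lt.
move=> z _; apply: cvgD; first by apply: cvg_norm; exact: cvg_fst.
by apply: cvgM; exact: cvg_snd.
Qed.

Lemma open_pencil_dom6 : open (pencil_dom (@A6 R) B6).
Proof.
rewrite pencil_dom6E.
rewrite (_ : mkset _ = (fun z : R * R => z.2 ^+ 2 - z.1) @^-1` [set x | x < 1]
   `&` (fun z : R * R => z.1) @^-1` [set x | x < 1]); last first.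
  apply/seteqP; split=> z /=; first by move=> /andP[h1 h2]; split; lra.
  by move=> [h1 h2]; apply/andP; split; lra.
apply: openI; apply: open_comp; try exact: open_lt; move=> z _; last exact: cvg_fst.
by apply: cvgB; [apply: cvgM; exact: cvg_snd|exact: cvg_fst].
Qed.

Lemma corrected8 (chi8 : 'cV[R]_((2 + 2) + (2 + 2)) -> 'cV[R]_((2 + 2) + (2 + 2))) X :
  correction_map A8 B8 S8 chi8 -> corrected A8 B8 X (chi8 X).
Proof.
apply: correctedP; last 1 first.
- move=> z; rewrite pencil_dom8E /= => h; have := sqr_ge0 z.2; have := normr_ge0 z.1.
  move=> h1 h2; split; first by lra.
  rewrite -(@ler_pXn2r _ 2) ?nnegrE // real_normK ?num_real //; lra.
- by apply: diag4_tr; [exact: trmx_Smx|apply: trmxN; exact: trmx_Smx].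
- by apply: diag4_tr; [exact: trmx_Tmx|apply: trmxN; exact: trmx_Tmx].
- exact: open_pencil_dom8.
Qed.

Lemma corrected6 (chi6 : 'cV[R]_((2 + 1) + (2 + 1)) -> 'cV[R]_((2 + 1) + (2 + 1))) X :
  correction_map A6 B6 S6 chi6 -> corrected A6 B6 X (chi6 X).
Proof.
apply: correctedP; last 1 first.
- move=> z; rewrite pencil_dom6E /= => /andP[h1 h2]; have := sqr_ge0 z.2 => h3; split.
    by rewrite ler_norml; apply/andP; split; lra.
  rewrite -(@ler_pXn2r _ 2) ?nnegrE // real_normK ?num_real //; lra.
- by apply: diag4_tr; [exact: trmx_Smx|apply: trmxN; exact: trmx1].
- by apply: diag4_tr; [exact: trmx_Tmx|exact: trmx0].
- exact: open_pencil_dom6.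
Qed.

Let sum2 (F : 'I_2 -> R) : \sum_i F i = F 0 + F 1.
Proof. by rewrite big_ord_recl big_ord1; congr (_ + F _); exact/val_inj. Qed.

Lemma bform_Smx (v : 'cV[R]_2) : bform Smx v v = v 0 0 ^+ 2.
Proof. by rewrite bformE !sum2 !mxE /=; ring. Qed.

Lemma bform_Tmx (v : 'cV[R]_2) : bform Tmx v v = 2 * (v 0 0 * v 1 0).
Proof. by rewrite bformE !sum2 !mxE /=; ring. Qed.

Lemma bform_id2 (v : 'cV[R]_2) : bform 1%:M v v = v 0 0 ^+ 2 + v 1 0 ^+ 2.
Proof. by rewrite bformE !sum2 !mxE /=; ring. Qed.

Lemma bform_id1 (v : 'cV[R]_1) : bform 1%:M v v = v 0 0 ^+ 2.
Proof. by rewrite bformE !big_ord1 !mxE /=; ring. Qed.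

Lemma bformNm N (P : 'M[R]_N) v : bform (- P) v v = - bform P v v.
Proof. by rewrite -scaleN1r bformZm mulN1r. Qed.

Lemma bform0m N (v : 'cV[R]_N) : bform 0 v v = 0 :> R.
Proof. by rewrite /bform mulmx0 mul0mx mxE. Qed.

Lemma bform_diag4 m n (P : 'M[R]_m) (Q : 'M[R]_n) X :
  bform (diag4 P Q) X X = bform P (blka X) (blka X) + bform Q (blkb X) (blkb X)
    + (bform P (blkc X) (blkc X) + bform Q (blkd X) (blkd X)).
Proof. by rewrite {1 2}(col4_blk X) /bform diag4_form. Qed.

Lemma diag4_1 m n : 1%:M = diag4 1%:M 1%:M :> 'M[R]_((m + n) + (m + n)).
Proof. by rewrite /diag4 !scalar_mx_block. Qed.

End CorrectionPencils.

(** * The two leading Chebyshev coefficients of a quadruplet *)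

Section Expansion.
Context {R : realType}.
Implicit Types (p : {poly R}) (c : nat -> R) (i j k m n : nat).

Lemma sum_basis_eq0 (B : nat -> {poly R}) c m : (forall i, size (B i) = i.+1) ->
  \sum_(0 <= j < m) c j *: B j = 0 -> forall i, (i < m)%N -> c i = 0.
Proof.
move=> sB; elim: m => // m IH; rewrite big_nat_recr //= => S0.
have cm : c m = 0.
  have sS : (size (\sum_(0 <= j < m) c j *: B j)%R <= m)%N.
    rewrite big_mkord; apply: (leq_trans (size_sum _ _ _)); apply/bigmax_leqP => j _.
    by rewrite (leq_trans (size_scale_leq _ _)) // sB.
  have Bm : (B m)`_m != 0.
    by rewrite -[m in _`_m]/(m.+1.-1) -(sB m) -lead_coefE lead_coef_eq0 -size_poly_eq0 sB.
  move/(congr1 (fun q : {poly R} => q`_m)): S0.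
  by rewrite coefD coefZ nth_default // add0r coef0 => /eqP; rewrite mulf_eq0 (negPf Bm) orbF => /eqP.
move: S0; rewrite cm scale0r addr0 => /IH {}IH i.
by rewrite ltnS leq_eqVlt => /orP[/eqP ->|/IH].
Qed.

Lemma expansionE (B : nat -> {poly R}) c m : (forall i, size (B i) = i.+1) ->
  forall i, (i < m)%N -> expansion B (\sum_(0 <= j < m) c j *: B j) i = c i.
Proof.
move=> sB i im; set p := \sum_(0 <= j < m) _.
have sp : (size p <= m)%N.
  rewrite /p big_mkord; apply: (leq_trans (size_sum _ _ _)); apply/bigmax_leqP => j _.
  by rewrite (leq_trans (size_scale_leq _ _)) // sB.
have [pE c0] := xgetPex (fun=> 0) (expansion_ex p sB).
rewrite -/(expansion B p) in pE c0.
apply/eqP; rewrite -subr_eq0; apply/eqP.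
apply: (sum_basis_eq0 (c := fun j => expansion B p j - c j)) sB _ i im.
under eq_bigr do rewrite scalerBl.
rewrite sumrB -/p [X in _ - X]pE -(big_mkord xpredT (fun i => expansion B p i *: B i)) (big_cat_nat _ sp) //=.
rewrite [X in _ + X - _]big_nat [X in _ + X - _]big1 ?addr0 ?subrr // => l /andP[pl _].
by rewrite c0 // scale0r.
Qed.

Lemma chebT_coef_sum c m i : (i < m)%N ->
  chebT_coef (\sum_(0 <= j < m) c j *: chebT j) i = c i.
Proof. exact: (expansionE c (@size_chebT R)). Qed.

Lemma chebU_coef_sum c m i : (0 < i < m)%N ->
  chebU_coef (\sum_(1 <= j < m) c j *: chebU j) i = c i.
Proof.
case: i m => [|i] [|m] //= im.
by rewrite big_add1; apply: (expansionE (fun j => c j.+1) (@size_chebU R)).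
Qed.

End Expansion.

Section TopPart.
Context {R : realType}.
Implicit Types (p : {poly R}) (q : quad R) (a b c d : 'cV[R]_2) (m n : nat).
Notation T := (@chebT R).
Notation U := (@chebU R).
Notation w := (@wpoly R).

Definition topT n a : {poly R} := a 0 0 *: T n + a 1 0 *: T n.-1.
Definition topU n b : {poly R} := b 0 0 *: U n + b 1 0 *: U n.-1.

Definition qtop n a b c d : quad R := (topT n a, topU n b, topT n c, topU n d).

Definition lowT n p := \sum_(0 <= i < n.-1) chebT_coef p i *: T i.
Definition lowU n p := \sum_(1 <= i < n.-1) chebU_coef p i *: U i.

Definition qlow n q : quad R :=
  let: (a, b, c, d) := q in (lowT n a, lowU n b, lowT n c, lowU n d).

Definition tcol n p := col2 (chebT_coef p n) (chebT_coef p n.-1).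
Definition ucol n p := col2 (chebU_coef p n) (chebU_coef p n.-1).

Lemma qtop_split n q : (0 < n)%N -> inQ n q -> let: (a, b, c, d) := q in
  q = qlow n q + qtop n (tcol n a) (ucol n b) (tcol n c) (ucol n d).
Proof.
case: n => // n _; case: q => [[[a b] c] d] [sa sb sc sd].
have ET p : (size p <= n.+2)%N -> p = lowT n.+1 p + topT n.+1 (tcol n.+1 p).
  move=> sp; rewrite {1}(chebT_coefE sp) !big_nat_recr //= -addrA; congr (_ + _).
  by rewrite /topT /tcol /col2 !mxE /= addrC.
have EU p : (size p <= n.+1)%N -> p = lowU n.+1 p + topU n.+1 (ucol n.+1 p).
  move=> sp; rewrite {1}(chebU_coefE sp) big_nat_recr //= /lowU /topU /ucol /col2 !mxE /=.
  case: n {ET sa sb sc sd sp} => [|n].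
    by rewrite !big_geq // scale0r addr0.
  by rewrite big_nat_recr //= -addrA [X in _ = _ + X]addrC.
rewrite -[_ + _ in RHS]/(lowT n.+1 a + topT n.+1 (tcol n.+1 a),
  lowU n.+1 b + topU n.+1 (ucol n.+1 b), lowT n.+1 c + topT n.+1 (tcol n.+1 c),
  lowU n.+1 d + topU n.+1 (ucol n.+1 d)).
by rewrite -!ET -?EU.
Qed.

(** Let X collect the coefficients, each column having its top coefficient first.
    Then [formA] is X^t A X, [formB] is half of X^t B X, [sqnorm8] is |X|^2, and
    [formA_low] is the analogue of [formA] for the second coefficients.  They
    are, up to factors 1/2, the Chebyshev coefficients of M on the top part. *)
Definition formA a b c d : R :=
  a 0 0 ^+ 2 - b 0 0 ^+ 2 + (c 0 0 ^+ 2 - d 0 0 ^+ 2).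
Definition formB a b c d : R :=
  a 0 0 * a 1 0 - b 0 0 * b 1 0 + (c 0 0 * c 1 0 - d 0 0 * d 1 0).
Definition formA_low a b c d : R :=
  a 1 0 ^+ 2 - b 1 0 ^+ 2 + (c 1 0 ^+ 2 - d 1 0 ^+ 2).
Definition sqnorm8 a b c d : R :=
  a 0 0 ^+ 2 + a 1 0 ^+ 2 + (b 0 0 ^+ 2 + b 1 0 ^+ 2)
  + (c 0 0 ^+ 2 + c 1 0 ^+ 2 + (d 0 0 ^+ 2 + d 1 0 ^+ 2)).
Definition cross_sum a b c d : R :=
  a 0 0 * a 1 0 + b 0 0 * b 1 0 + (c 0 0 * c 1 0 + d 0 0 * d 1 0).

(** For n = 0 some of the polynomials T_i on the right coincide. *)
Lemma Mq_qtop n a b c d :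
  Mq (qtop n.+1 a b c d) = (sqnorm8 a b c d / 2)%:P + (cross_sum a b c d) *: T 1
    + (formA_low a b c d / 2) *: T (n + n)%N + (formB a b c d) *: T (n.+1 + n)%N
    + (formA a b c d / 2) *: T (n.+1 + n.+1)%N.
Proof.
apply: poly_xi_ext => t tpi.
have s0 : sin t != 0 by rewrite gt_eqF // sin_gt0_pi.
set al : R := n.+1%:R * t; set be : R := n%:R * t.
have E1 : (T 1).[xi t] = cos al * cos be + sin al * sin be.
  by rewrite chebT_cos mul1r -cosB /al -[n.+1]addn1 natrD mulrDl mul1r /be addrC addKr.
move: (T 1) E1 => T1 E1.
rewrite /Mq /qtop /topT /topU !(horner_wpoly_xi, hornerD, horner_exp, hornerM, hornerZ, hornerC).
rewrite !chebU_xiE // !chebT_cos (natrD _ n n) !(natrD _ n.+1) E1.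
rewrite (mulrDl n%:R n%:R t) !(mulrDl n.+1%:R _ t) -/al -/be !cosD.
have ha := cos2Dsin2 al; have hb := cos2Dsin2 be.
have -> : sqnorm8 a b c d / 2 =
    (a 0 0 ^+ 2 + b 0 0 ^+ 2 + c 0 0 ^+ 2 + d 0 0 ^+ 2) * (cos al ^+ 2 + sin al ^+ 2) / 2
  + (a 1 0 ^+ 2 + b 1 0 ^+ 2 + c 1 0 ^+ 2 + d 1 0 ^+ 2) * (cos be ^+ 2 + sin be ^+ 2) / 2.
  by rewrite ha hb /sqnorm8; ring.
rewrite /cross_sum /formA_low /formB /formA /=; move: (cos al) (sin al) (cos be) (sin be) => x y z v.
by field.
Qed.

(** The shape of what remains once the coefficients of index n + 1 and n are
    removed.  It is not [inQ n.-1 q], because for n = 0 the remainder is 0. *)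
Definition inLow n q : Prop :=
  let: (a, b, c, d) := q in
  [/\ (size a <= n)%N, (size b <= n.-1)%N, (size c <= n)%N & (size d <= n.-1)%N].

Lemma inLow_qlow n q : inLow n (qlow n.+1 q).
Proof.
have ST p : (size (lowT n.+1 p) <= n)%N.
  rewrite /lowT /= big_mkord; apply: (leq_trans (size_sum _ _ _)).
  apply/bigmax_leqP => j _.
  by rewrite (leq_trans (size_scale_leq _ _)) // size_chebT.
have SU p : (size (lowU n.+1 p) <= n.-1)%N.
  rewrite /lowU -[n.+1.-1]/n big_add1 big_mkord; apply: (leq_trans (size_sum _ _ _)).
  apply/bigmax_leqP => j _.
  by rewrite (leq_trans (size_scale_leq _ _)) // (leq_trans (size_chebU_le _)).
by case: q => [[[a b] c] d]; split.
Qed.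

Lemma size_topT n a : (size (topT n.+1 a) <= n.+2)%N.
Proof.
rewrite (leq_trans (size_polyD _ _)) // geq_max !(leq_trans (size_scale_leq _ _)) //.
  by rewrite size_chebT.
by rewrite size_chebT.
Qed.

Lemma size_topU n b : (size (topU n.+1 b) <= n.+1)%N.
Proof.
rewrite (leq_trans (size_polyD _ _)) // geq_max; apply/andP; split;
  apply: (leq_trans (size_scale_leq _ _)); first exact: size_chebU_le.
exact: leq_trans (size_chebU_le _) _.
Qed.

Lemma size_wpoly : (size w <= 3)%N.
Proof.
have h : (size (1 - 'X : {poly R})%R <= 2)%N.
  by rewrite (leq_trans (size_polyD _ _)) // size_polyN size_polyX size_poly1.
apply: leq_trans (size_polyMleq _ _) _; rewrite size_polyX.
by move: (size _) h => k; lia.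
Qed.

Lemma cint_qdot_low_top n r a b c d : inLow n r -> cint (qdot r (qtop n.+1 a b c d)) = 0.
Proof.
case: r => [[[ra rb] rc] rd] [sa sb sc sd]; rewrite /qdot /qtop.
have HT p v : (size p <= n)%N -> cint (p * topT n.+1 v) = 0.
  move=> sp; rewrite /topT mulrDr -!scalerAr cintD !cintZ.
  by rewrite !cintM_chebT_eq0 ?(leqW sp) // !mulr0 addr0.
have HU p v : (size p <= n.-1)%N -> cint (p * topU n.+1 v * w) = 0.
  case: (n) => [|m] sp.
    have -> : p = 0 by apply/eqP; rewrite -size_poly_leq0.
    by rewrite !mul0r raddf0.
  rewrite /topU mulrDr mulrDl -!scalerAr -!scalerAl cintD !cintZ.
  by rewrite !cintM_chebUw_eq0 ?ltnS // ?(leqW sp) // !mulr0 addr0.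
by rewrite !cintD !HT // !HU // !addr0.
Qed.

Lemma size_MqD_sub_top n r a b c d : inLow n r ->
  (size (Mq (r + qtop n.+1 a b c d) - Mq (qtop n.+1 a b c d))%R <= (n + n).+1)%N.
Proof.
move=> rl; have [n0|n0] := posnP n.
  have -> : r = 0.
    case: r rl => [[[ra rb] rc] rd]; rewrite n0 /=.
    by rewrite !size_poly_leq0 => -[/eqP -> /eqP -> /eqP -> /eqP ->].
  by rewrite add0r subrr size_poly0.
rewrite MqD addrK.
have sM p p' k k' : (size p <= k)%N -> (size p' <= k')%N -> (size (p * p')%R <= (k + k').-1)%N.
  move=> pk pk'; apply: (leq_trans (size_polyMleq _ _)).
  by rewrite -!subn1 leq_sub2r // leq_add.
have sD p p' k : (size p <= k)%N -> (size p' <= k)%N -> (size (p + p')%R <= k)%N.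
  by move=> h h'; rewrite (leq_trans (size_polyD _ _)) // geq_max h.
have le p k k' : (size p <= k)%N -> (k <= k')%N -> (size p <= k')%N by exact: leq_trans.
case: r rl => [[[ra rb] rc] rd] [sa sb sc sd].
have HT p v : (size p <= n)%N -> (size (p * topT n.+1 v)%R <= (n + n).+1)%N.
  by move=> sp; apply: le (sM _ _ _ _ sp (size_topT _ _)) _; lia.
have HU p v : (size p <= n.-1)%N -> (size (p * topU n.+1 v * w)%R <= (n + n).+1)%N.
  by move=> sp; apply: le (sM _ _ _ _ (sM _ _ _ _ sp (size_topU _ _)) size_wpoly) _; lia.
have HT2 p : (size p <= n)%N -> (size (p ^+ 2)%R <= (n + n).+1)%N.
  by move=> sp; rewrite expr2; apply: le (sM _ _ _ _ sp sp) _; lia.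
have HU2 p : (size p <= n.-1)%N -> (size (p ^+ 2 * w)%R <= (n + n).+1)%N.
  by move=> sp; rewrite expr2; apply: le (sM _ _ _ _ (sM _ _ _ _ sp sp) size_wpoly) _; lia.
rewrite mulr2n /qdot /qtop /Mq.
by do !apply: (sD _ _ _); rewrite ?HT ?HU ?HT2 ?HU2.
Qed.

Lemma cint_chebT_sqr k : cint (T k.+1 * T k.+1) = pi / 2.
Proof. by rewrite chebTM // cintZ cintD !cint_chebT subnn /= add0r mulrC. Qed.

Section TopCoefficients.
Variables (n : nat) (r : quad R) (a b c d : 'cV[R]_2).
Hypothesis rlow : inLow n r.
Hypothesis b0 : n = 0%N -> b 1 0 = 0.
Hypothesis d0 : n = 0%N -> d 1 0 = 0.
Let q := r + qtop n.+1 a b c d.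

Lemma cint_top_reduce k : (n + n < k)%N -> cint (Mq q * T k) = cint (Mq (qtop n.+1 a b c d) * T k).
Proof.
move=> nk; apply/eqP; rewrite -subr_eq0 -cintB -mulrBl.
by rewrite cintM_chebT_eq0 // (leq_trans (size_MqD_sub_top _ _ _ _ rlow)).
Qed.

Let cT i k : (i < k)%N -> cint (T i * T k) = 0.
Proof. by move=> ik; rewrite cintM_chebT_eq0 // size_chebT. Qed.

Let cint5 (x y1 y2 y3 y4 : R) (P1 P2 P3 P4 : {poly R}) k : (0 < k)%N ->
  cint ((x%:P + y1 *: P1 + y2 *: P2 + y3 *: P3 + y4 *: P4) * T k) =
  y1 * cint (P1 * T k) + y2 * cint (P2 * T k) + y3 * cint (P3 * T k) + y4 * cint (P4 * T k).
Proof.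
move=> k0; rewrite !mulrDl -!scalerAl !cintD !cintZ.
by rewrite cintM_chebT_eq0 ?add0r // (leq_trans (size_polyC_leq1 _)).
Qed.

Lemma cint_Mq_top2 : cint (Mq q * T (n.+1 + n.+1)%N) = pi / 4 * formA a b c d.
Proof.
rewrite cint_top_reduce ?addnS ?addSn // ?ltnS ?leqnSn //.
rewrite Mq_qtop cint5 ?addSn //.
rewrite !addnS cint_chebT_sqr !cT; [|lia..].
by rewrite !mulr0 !add0r; field.
Qed.

Lemma cint_Mq_top1 :
  cint (Mq q * T (n.+1 + n)%N) = (if n == 0%N then pi else pi / 2) * formB a b c d.
Proof.
rewrite cint_top_reduce ?addSn //.
rewrite Mq_qtop cint5 ?addSn //.
rewrite cint_chebT_sqr (cT (i := (n + n)%N)) // (mulrC (T (n + n.+1).+1)) (cT (k := (n + n.+1).+1)) ?addnS //.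
rewrite !mulr0 !addr0.
case: n b0 d0 => [|m] hb hd.
  by rewrite cint_chebT_sqr /cross_sum /formB hb // hd //=; field.
by rewrite cT // mulr0 add0r mulrC.
Qed.

(** M(q) and the defect M(q) - 1 have the same coefficients of positive index,
    and testing the defect against a Chebyshev polynomial, bounded by 1, costs
    at most its norm. *)
Lemma top_coefficients_le :
  pi * (`|formA a b c d| + 4 * `|formB a b c d|) <= 12 * pnorm (qeps q).
Proof.
have pi0 := pi_gt0 R.
have E k : (0 < k)%N -> `|cint (Mq q * T k)| <= pnorm (qeps q).
  move=> k0; have -> : cint (Mq q * T k) = cint (qeps q * T k).
    by rewrite /qeps mulrBl cintB mul1r (cint_chebT k) gtn_eqF // subr0.
  by apply: norm_cintM_le => t; exact: norm_chebT_le1.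
have := E _ (ltn0Sn (n + n.+1)); rewrite -addSn cint_Mq_top2 normrM gtr0_norm ?divr_gt0 // => h2.
have := E _ (ltn0Sn (n + n)); rewrite -addSn cint_Mq_top1 normrM.
have : pi / 2 * `|formB a b c d| <= `|if n == 0%N then pi else pi / 2| * `|formB a b c d|.
  apply: ler_wpM2r => //; case: ifP => _; rewrite ger0_norm ?divr_ge0 ?(ltW pi0) //.
  by rewrite ler_piMr ?(ltW pi0) // invf_le1 // ler1n.
move=> h3 h1; lra.
Qed.

Lemma cint_Mq_qtop : cint (Mq (qtop n.+1 a b c d)) =
  pi / 2 * (sqnorm8 a b c d + if n == 0%N then formA_low a b c d else 0).
Proof.
rewrite Mq_qtop !cintD !cintZ -alg_polyC cintZ [in cint 1](_ : 1 = T 0) //.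
rewrite !cint_chebT addn_eq0 andbb /=; case: ifP => _; by field.
Qed.

Lemma qnorm_sqr_low_top : qnorm q ^+ 2 = qnorm r ^+ 2 +
  pi / 2 * (sqnorm8 a b c d + if n == 0%N then formA_low a b c d else 0).
Proof.
rewrite !qnorm_sqr /q MqD mulr2n -cint_Mq_qtop.
rewrite (cintD _ (Mq (qtop _ _ _ _ _))) (cintD (Mq r)) (cintD (qdot _ _)).
by rewrite cint_qdot_low_top // !addr0.
Qed.

(** T_0 has twice the energy of the other Chebyshev polynomials, so that for
    n = 0 the constant coefficients weigh more in the norm than in |X|^2. *)
Lemma top_energy_bounds : let e := sqnorm8 a b c d + if n == 0%N then formA_low a b c d else 0 in
  sqnorm8 a b c d <= e <= 2 * sqnorm8 a b c d /\ (n != 0%N -> e = sqnorm8 a b c d).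
Proof.
rewrite /=; case: eqP => [n0|_]; split=> //.
- have hb := b0 n0; have hd := d0 n0; rewrite /sqnorm8 /formA_low hb hd.
  have := sqr_ge0 (a 0 0); have := sqr_ge0 (a 1 0); have := sqr_ge0 (c 0 0).
  have := sqr_ge0 (c 1 0); have := sqr_ge0 (b 0 0); have := sqr_ge0 (d 0 0).
  by move=> *; apply/andP; split; lra.
- have : 0 <= sqnorm8 a b c d by rewrite !addr_ge0 ?sqr_ge0.
  by move=> h; apply/andP; split; lra.
- by rewrite addr0.
Qed.

End TopCoefficients.

End TopPart.

(** * Estimates for the correction *)

Section CorrectionStep.
Context {R : realType}.
Implicit Types (q r : quad R) (a b c d : 'cV[R]_2) (n : nat).
Notation T := (@chebT R).
Notation U := (@chebU R).

Lemma blk_col4 m k (a : 'cV[R]_m) (b : 'cV[R]_k) (c : 'cV[R]_m) (d : 'cV[R]_k) :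
  [/\ blka (col4 a b c d) = a, blkb (col4 a b c d) = b,
      blkc (col4 a b c d) = c & blkd (col4 a b c d) = d].
Proof. by rewrite /blka /blkb /blkc /blkd /col4 !(col_mxKu, col_mxKd). Qed.

(** What the correction achieves, stated on columns of size 2 for the components
    b and d too; in degree 1 their second entry, a coefficient of U_0 = 0, is
    set to 0. *)
Record top_corrected n a b c d a' b' c' d' : Prop := TopCorrected {
  tc_dif2 : formA a' b' c' d' = 0;
  tc_dif11 : formB a' b' c' d' = 0;
  tc_tot : sqnorm8 a' b' c' d' <= sqnorm8 a b c d;
  tc_dist : sqnorm8 (a - a') (b - b') (c - c') (d - d') <=
    `|formA a b c d| + 4 * `|formB a b c d|;
  tc_b0 : n = 0%N -> b 1 0 = 0 /\ b' 1 0 = 0;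
  tc_d0 : n = 0%N -> d 1 0 = 0 /\ d' 1 0 = 0 }.

Variables (chi8 : 'cV[R]_((2 + 2) + (2 + 2)) -> 'cV[R]_((2 + 2) + (2 + 2)))
          (chi6 : 'cV[R]_((2 + 1) + (2 + 1)) -> 'cV[R]_((2 + 1) + (2 + 1))).
Hypotheses (hchi8 : correction_map A8 B8 S8 chi8)
           (hchi6 : correction_map A6 B6 S6 chi6).

Lemma bform8 (X : 'cV[R]_((2 + 2) + (2 + 2))) :
  [/\ bform A8 X X = formA (blka X) (blkb X) (blkc X) (blkd X),
      bform B8 X X = 2 * formB (blka X) (blkb X) (blkc X) (blkd X)
    & bform 1%:M X X = sqnorm8 (blka X) (blkb X) (blkc X) (blkd X)].
Proof.
rewrite /A8 /B8 diag4_1 !bform_diag4 !bformNm !bform_Smx !bform_Tmx !bform_id2.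
by split=> //; rewrite /formB; ring.
Qed.

Definition pad (v : 'cV[R]_1) : 'cV[R]_2 := col2 (v 0 0) 0.

Lemma bform6 (X : 'cV[R]_((2 + 1) + (2 + 1))) :
  [/\ bform A6 X X = formA (blka X) (pad (blkb X)) (blkc X) (pad (blkd X)),
      bform B6 X X = 2 * formB (blka X) (pad (blkb X)) (blkc X) (pad (blkd X))
    & bform 1%:M X X = sqnorm8 (blka X) (pad (blkb X)) (blkc X) (pad (blkd X))].
Proof.
rewrite /A6 /B6 diag4_1 !bform_diag4 !bformNm !bform0m !bform_Smx !bform_Tmx.
rewrite !bform_id2 !bform_id1 /formA /formB /sqnorm8 /pad /col2 !mxE /=.
by split=> //; ring.
Qed.

Lemma chi_fun_split n q : inQ n.+1 q -> exists a b c d a' b' c' d',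
  [/\ q = qlow n.+1 q + qtop n.+1 a b c d,
      chi_fun chi8 chi6 n.+1 q = qlow n.+1 q + qtop n.+1 a' b' c' d'
    & top_corrected n a b c d a' b' c' d'].
Proof.
move=> qQ; have := qtop_split (ltn0Sn n) qQ; case: q qQ => [[[pa pb] pc] pd] qQ qE.
exists (tcol n.+1 pa), (ucol n.+1 pb), (tcol n.+1 pc), (ucol n.+1 pd).
case: n qQ qE => [|n] qQ qE.
  pose X := col4 (tcol 1 pa) (chebU_coef pb 1)%:M (tcol 1 pc) (chebU_coef pd 1)%:M.
  pose Y := chi6 X.
  exists (blka Y), (pad (blkb Y)), (blkc Y), (pad (blkd Y)); split=> //.
    rewrite /chi_fun /= -/X -/Y /qtop.
    rewrite -[_ + _ in RHS]/(lowT 1 pa + topT 1 (blka Y), lowU 1 pb + topU 1 (pad (blkb Y)),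
      lowT 1 pc + topT 1 (blkc Y), lowU 1 pd + topU 1 (pad (blkd Y))).
    rewrite /lowT /lowU /topT /topU !big_geq // !add0r /pad /col2 !mxE /= !scaler0 !addr0.
    by rewrite -!alg_polyC.
  have [Ea Eb Ec Ed] := blk_col4 (tcol 1 pa) (chebU_coef pb 1)%:M (tcol 1 pc) (chebU_coef pd 1)%:M.
  have pE p : pad (chebU_coef p 1)%:M = ucol 1 p.
    by apply/colP => i; rewrite !mxE /= mulr1n.
  have pB (u v : 'cV[R]_1) : pad (u - v) = pad u - pad v.
    by apply/colP => i; rewrite !mxE; case: ifP => _; rewrite ?subr0.
  have [] := corrected6 X hchi6; rewrite -/Y.
  have [-> -> ->] := bform6 X; have [-> -> ->] := bform6 Y.
  have [_ _ ->] := bform6 (X - Y).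
  rewrite /blka /blkb /blkc /blkd !linearB /= -/(blka X) -/(blkb X) -/(blkc X) -/(blkd X).
  rewrite Ea Eb Ec Ed !pB !pE => h1 h2 h3 h4; split=> //.
  - by lra.
  - by move: h4; rewrite normrM ger0_norm //; lra.
  - by rewrite !mxE.
  - by rewrite !mxE.
pose X := col4 (tcol n.+2 pa) (ucol n.+2 pb) (tcol n.+2 pc) (ucol n.+2 pd).
pose Y := chi8 X.
exists (blka Y), (blkb Y), (blkc Y), (blkd Y); split=> //.
have [Ea Eb Ec Ed] := blk_col4 (tcol n.+2 pa) (ucol n.+2 pb) (tcol n.+2 pc) (ucol n.+2 pd).
have [] := corrected8 X hchi8; rewrite -/Y.
have [-> -> ->] := bform8 X; have [-> -> ->] := bform8 Y.
have [_ _ ->] := bform8 (X - Y).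
rewrite /blka /blkb /blkc /blkd !linearB /= -/(blka X) -/(blkb X) -/(blkc X) -/(blkd X).
rewrite Ea Eb Ec Ed => h1 h2 h3 h4; split=> //.
- by lra.
- by move: h4; rewrite normrM ger0_norm //; lra.
Qed.

Lemma qtopB n a b c d a' b' c' d' : qtop n a b c d - qtop n a' b' c' d' =
  qtop n (a - a') (b - b') (c - c') (d - d').
Proof.
have ET (P : nat -> {poly R}) (u v : 'cV[R]_2) :
    u 0 0 *: P n + u 1 0 *: P n.-1 - (v 0 0 *: P n + v 1 0 *: P n.-1) =
    (u - v) 0 0 *: P n + (u - v) 1 0 *: P n.-1.
  by rewrite !mxE !scalerBl opprD addrACA.
by rewrite /qtop /topT /topU -!ET.
Qed.

Section Estimates.
Variables (n : nat) (r : quad R) (a b c d a' b' c' d' : 'cV[R]_2).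
Hypotheses (rlow : inLow n r) (tc : top_corrected n a b c d a' b' c' d').
Let q := r + qtop n.+1 a b c d.
Let qh := r + qtop n.+1 a' b' c' d'.

Lemma correction_dist : qnorm (q - qh) ^+ 2 <= 12 * pnorm (qeps q).
Proof.
have -> : q - qh = 0 + qtop n.+1 (a - a') (b - b') (c - c') (d - d').
  by rewrite /q /qh opprD addrACA subrr qtopB.
have z0 : inLow n (0 : quad R) by split; rewrite size_poly0.
have hb : n = 0%N -> (b - b') 1 0 = 0 by move/(tc_b0 tc) => [h1 h2]; rewrite !mxE h1 h2 subrr.
have hd : n = 0%N -> (d - d') 1 0 = 0 by move/(tc_d0 tc) => [h1 h2]; rewrite !mxE h1 h2 subrr.
rewrite (qnorm_sqr_low_top _ _ _ _ z0).
have -> : qnorm (0 : quad R) ^+ 2 = 0.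
  by rewrite qnorm_sqr -(scale0r (0 : quad R)) MqZ expr0n scale0r raddf0.
rewrite add0r.
have [/andP[_ h1] _] := top_energy_bounds (a - a') (c - c') hb hd.
have pi0 := pi_gt0 R.
have h2 := tc_dist tc.
have h3 := top_coefficients_le a c rlow (fun h => proj1 (tc_b0 tc h)) (fun h => proj1 (tc_d0 tc h)).
apply: (le_trans _ h3); apply: (@le_trans _ _ (pi / 2 * (2 * sqnorm8 (a - a') (b - b') (c - c') (d - d')))).
  by rewrite ler_wpM2l // divr_ge0 // ltW.
move: (ler_wpM2l (ltW pi0) h2); move: (sqnorm8 _ _ _ _) => x; move: (`|_| + _) => y; lra.
Qed.

Lemma correction_norm : qnorm qh <= (if n == 0%N then 2 else 1) * qnorm q.
Proof.
rewrite -(@ler_pXn2r _ 2) ?nnegrE ?qnorm_ge0 //; last first.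
  by rewrite mulr_ge0 ?qnorm_ge0 //; case: ifP.
rewrite exprMn /q /qh (qnorm_sqr_low_top a b c d rlow) (qnorm_sqr_low_top a' b' c' d' rlow).
have pi0 := pi_gt0 R; have r0 := sqr_ge0 (qnorm r).
have [/andP[h1 h2] h3] := top_energy_bounds a c (fun h => proj1 (tc_b0 tc h)) (fun h => proj1 (tc_d0 tc h)).
have [/andP[h1' h2'] h3'] := top_energy_bounds a' c' (fun h => proj2 (tc_b0 tc h)) (fun h => proj2 (tc_d0 tc h)).
have h4 := tc_tot tc; have t0 : 0 <= sqnorm8 a' b' c' d' by rewrite !addr_ge0 ?sqr_ge0.
move: h1 h2 h3 h1' h2' h3'; case: eqP => [n0|n0] /= h1 h2 h3 h1' h2' h3'.
  clear h3'; move: h1 h2 h1' h2' h4 t0; move: (sqnorm8 _ _ _ _) (sqnorm8 _ _ _ _) (formA_low _ _ _ _) (formA_low _ _ _ _) 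
    => x y z v h1 h2 h1' h2' h4 t0.
  have : pi / 2 * (x + z) <= pi / 2 * (2 * (y + v)).
    by rewrite ler_wpM2l ?divr_ge0 ?(ltW pi0) //; lra.
  have : 0 <= pi / 2 * (y + v) by rewrite mulr_ge0 ?divr_ge0 ?(ltW pi0) //; lra.
  lra.
move: h4 t0; move: (sqnorm8 a b c d) (sqnorm8 a' b' c' d') => y x h4 t0.
have : pi / 2 * (x + 0) <= pi / 2 * (y + 0).
  by rewrite ler_wpM2l ?divr_ge0 ?(ltW pi0) //; lra.
lra.
Qed.

End Estimates.

End CorrectionStep.

(** * Factorization of a corrected quadruplet *)

Section TwoLeadingCoefficients.
Context {R : realType}.
Implicit Types (p : {poly R}) (v : 'cV[R]_2) (n k : nat) (x y : R).
Notation T := (@chebT R).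
Notation U := (@chebU R).
Notation w := (@wpoly R).

Lemma chebT_coef_top n p v : (size p <= n)%N ->
  chebT_coef (p + topT n.+1 v) n.+1 = v 0 0 /\ chebT_coef (p + topT n.+1 v) n = v 1 0.
Proof.
move=> sp.
pose c j := if (j < n)%N then chebT_coef p j else if j == n then v 1 0 else v 0 0.
have -> : p + topT n.+1 v = \sum_(0 <= j < n.+2) c j *: T j.
  rewrite !big_nat_recr //= /c !ltnn ltnNge leqnSn /= eqxx gtn_eqF // -addrA.
  congr (_ + _); last by rewrite addrC.
  rewrite big_nat; under eq_bigr => i /andP[_ ->] do rewrite /=.
  rewrite -big_nat; case: (n) sp => [|m] sp; last exact: chebT_coefE.
  by rewrite big_geq //; apply/eqP; rewrite -size_poly_leq0.
by rewrite !chebT_coef_sum // /c !ltnn ltnNge leqnSn /= eqxx gtn_eqF.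
Qed.

Lemma chebU_coef_top n p v : (size p <= n.-1)%N -> (0 < n)%N ->
  chebU_coef (p + topU n.+1 v) n.+1 = v 0 0 /\ chebU_coef (p + topU n.+1 v) n = v 1 0.
Proof.
move=> sp n0.
pose c j := if (j < n)%N then chebU_coef p j else if j == n then v 1 0 else v 0 0.
have -> : p + topU n.+1 v = \sum_(1 <= j < n.+2) c j *: U j.
  rewrite !big_nat_recr //= /c !ltnn ltnNge leqnSn /= eqxx gtn_eqF // -addrA.
  congr (_ + _); last by rewrite addrC.
  rewrite big_nat; under eq_bigr => i /andP[_ ->] do rewrite /=.
  by rewrite -big_nat {1}(chebU_coefE sp) prednK.
by rewrite !chebU_coef_sum ?n0 ?ltnS ?leqnSn //= /c !ltnn ltnNge leqnSn /= eqxx gtn_eqF.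
Qed.

(** p has coefficients x and y on B_(n+2) and B_(n+1), up to a remainder of size
    at most k. *)
Definition lead2 (B : nat -> {poly R}) n k x y p : Prop :=
  (size (p - (x *: B n.+2 + y *: B n.+1))%R <= k)%N.

Lemma lead2D B n k x y x' y' p p' : lead2 B n k x y p -> lead2 B n k x' y' p' ->
  lead2 B n k (x + x') (y + y') (p + p').
Proof.
rewrite /lead2 => h h'.
rewrite !scalerDl (addrACA (x *: _)) opprD addrACA.
by rewrite (leq_trans (size_polyD _ _)) // geq_max h.
Qed.

Lemma lead2N B n k x y p : lead2 B n k x y p -> lead2 B n k (- x) (- y) (- p).
Proof. by rewrite /lead2 => h; rewrite !scaleNr -!opprD size_polyN. Qed.

Lemma lead2_size B n k x y p : x = 0 -> y = 0 -> lead2 B n k x y p -> (size p <= k)%N.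
Proof. by rewrite /lead2 => -> ->; rewrite !scale0r addr0 subr0. Qed.

Section Pieces.
Variables (n : nat) (n0 : (0 < n)%N).

Let sM p p' k k' m : (size p <= k)%N -> (size p' <= k')%N -> ((k + k').-1 <= m)%N ->
  (size (p * p')%R <= m)%N.
Proof.
move=> pk pk'; apply: leq_trans; apply: (leq_trans (size_polyMleq _ _)).
by rewrite -!subn1 leq_sub2r // leq_add.
Qed.

Let sD p p' k : (size p <= k)%N -> (size p' <= k)%N -> (size (p + p')%R <= k)%N.
Proof. by move=> h h'; rewrite (leq_trans (size_polyD _ _)) // geq_max h. Qed.

Let sZ x p k : (size p <= k)%N -> (size (x *: p)%R <= k)%N.
Proof. by move=> h; rewrite (leq_trans (size_scale_leq _ _)). Qed.

Let sl x y : (size (x *: T 1 + y%:P)%R <= 2)%N.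
Proof.
apply: sD; first by apply: sZ; rewrite size_chebT.
exact: leq_trans (size_polyC_leq1 _) _.
Qed.

Let hT m t : (0 < m)%N ->
  (T m.+1).[xi t] = 2 * (T m).[xi t] * (T 1).[xi t] - (T m.-1).[xi t].
Proof.
move=> m0; have /(congr1 (horner^~ (xi t))) := @chebTM R m 1 m0.
by rewrite addn1 subn1 hornerM hornerZ hornerD -mulrA => ->; field.
Qed.

Let hU m t : (0 < m)%N ->
  (U m.+1).[xi t] = 2 * (U m).[xi t] * (T 1).[xi t] - (U m.-1).[xi t].
Proof.
move=> m0; have /(congr1 (horner^~ (xi t))) := @chebUTM R m 1 m0.
by rewrite addn1 subn1 hornerM hornerZ hornerD -mulrA => ->; field.
Qed.

Let hUw m t : (0 < m)%N ->
  (U m).[xi t] * w.[xi t] = ((T m.-1).[xi t] - (T m.+1).[xi t]) / 4.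
Proof.
move=> m0; have /(congr1 (horner^~ (xi t))) := @chebUMw R m 1 m0.
move: w => W; rewrite addn1 subn1 [U 1]/(2%:P) !hornerM hornerZ hornerD hornerN hornerC => h.
have -> : (U m).[xi t] * W.[xi t] = (U m).[xi t] * 2 * W.[xi t] / 2 by field.
by rewrite h; field.
Qed.

Let hTU m t : (0 < m)%N ->
  (T m).[xi t] = ((U m.+1).[xi t] - (U m.-1).[xi t]) / 4.
Proof.
move=> m0; have /(congr1 (horner^~ (xi t))) := @chebTUM R m 1 m0.
rewrite addn1 subn1 [U 1]/(2%:P) !hornerM hornerZ hornerD hornerN hornerC => h.
have -> : (T m).[xi t] = (T m).[xi t] * 2 / 2 by field.
by rewrite h; field.
Qed.

Lemma lead2_TT x y p v : (size p <= n)%N ->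
  lead2 T n n.+1 (x * v 0 0 / 2) (y * v 0 0 + x * v 1 0 / 2)
    ((x *: T 1 + y%:P) * (p + topT n.+1 v)).
Proof.
move=> sp; rewrite /lead2; set l := _ - _.
have -> : l = (x *: T 1 + y%:P) * p +
    ((x * v 0 0 / 2 + y * v 1 0) *: T n + (x * v 1 0 / 2) *: T n.-1).
  apply: poly_xi_ext => t _.
  have h1 := hT t (ltn0Sn n); have h2 := hT t n0.
  rewrite -[n.+1.-1]/n in h1; rewrite /l /topT -[n.+1.-1]/n; move: (T 1) (T n.+2) h1 h2 => T1 T2.
  rewrite !(hornerD, hornerN, hornerM, hornerZ, hornerC) => -> ->.
  by field.
apply: sD; first by apply: sM (sl _ _) sp _; lia.
apply: sD; apply: sZ; rewrite size_chebT //; lia.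
Qed.

Lemma lead2_UU x p v : (size p <= n.-1)%N ->
  lead2 T n n.+1 (- (x * v 0 0 / 2)) (- (x * v 1 0 / 2))
    ((x *: U 1) * (p + topU n.+1 v) * w).
Proof.
move=> sp; rewrite /lead2; set l := _ - _.
have -> : l = (x *: U 1) * p * w +
    ((x * v 0 0 / 2) *: T n + (x * v 1 0 / 2) *: T n.-1).
  apply: poly_xi_ext => t _.
  have h1 := hUw t (ltn0Sn n); have h2 := hUw t n0.
  rewrite -[n.+1.-1]/n in h1; rewrite /l /topU [U 1]/(2%:P) -[n.+1.-1]/n; move: (T n.+2) h1 => T2.
  move: w h2 => W.
  rewrite !(hornerD, hornerN, hornerM, hornerZ, hornerC) => h2 h1.
  apply/eqP; rewrite -subr_eq0; apply/eqP.
  set L := LHS.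
  have -> : L = 2 * x * v 0 0 * ((U n.+1).[xi t] * W.[xi t] - ((T n).[xi t] - T2.[xi t]) / 4)
    + 2 * x * v 1 0 * ((U n).[xi t] * W.[xi t] - ((T n.-1).[xi t] - (T n.+1).[xi t]) / 4).
    by rewrite /L; field.
  by rewrite h1 h2 !subrr !mulr0 addr0.
apply: sD.
  have h : (size ((x *: U 1) * p)%R <= n.-1)%N.
    by apply: sM (sZ x (size_chebU_le 1)) sp _; lia.
  by apply: sM h size_wpoly _; lia.
apply: sD; apply: sZ; rewrite size_chebT //; lia.
Qed.

Lemma lead2_TU x y p v : (size p <= n.-1)%N ->
  lead2 U n n (x * v 0 0 / 2) (y * v 0 0 + x * v 1 0 / 2)
    ((x *: T 1 + y%:P) * (p + topU n.+1 v)).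
Proof.
move=> sp; rewrite /lead2; set l := _ - _.
have -> : l = (x *: T 1 + y%:P) * p +
    ((x * v 0 0 / 2 + y * v 1 0) *: U n + (x * v 1 0 / 2) *: U n.-1).
  apply: poly_xi_ext => t _.
  have h1 := hU t (ltn0Sn n); have h2 := hU t n0.
  rewrite -[n.+1.-1]/n in h1; rewrite /l /topU -[n.+1.-1]/n; move: (T 1) (U n.+2) h1 h2 => T1 T2.
  rewrite !(hornerD, hornerN, hornerM, hornerZ, hornerC) => -> ->.
  by field.
apply: sD; first by apply: sM (sl _ _) sp _; lia.
apply: sD; apply: sZ; rewrite (leq_trans (size_chebU_le _)) //; lia.
Qed.

Lemma lead2_UT x p v : (size p <= n)%N ->
  lead2 U n n (x * v 0 0 / 2) (x * v 1 0 / 2)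
    ((x *: U 1) * (p + topT n.+1 v)).
Proof.
move=> sp; rewrite /lead2; set l := _ - _.
have -> : l = (x *: U 1) * p +
    ((- (x * v 0 0 / 2)) *: U n + (- (x * v 1 0 / 2)) *: U n.-1).
  apply: poly_xi_ext => t _.
  have h1 := hTU t (ltn0Sn n); have h2 := hTU t n0.
  rewrite -[n.+1.-1]/n in h1; rewrite /l /topT [U 1]/(2%:P) -[n.+1.-1]/n; move: (U n.+2) h1 => T2.
  rewrite !(hornerD, hornerN, hornerM, hornerZ, hornerC) => ->; rewrite h2.
  by field.
apply: sD.
  by apply: sM (sZ x (size_chebU_le 1)) sp _; lia.
apply: sD; apply: sZ; rewrite (leq_trans (size_chebU_le _)) //; lia.
Qed.

End Pieces.
End TwoLeadingCoefficients.

Section Factorization.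
Context {R : realType}.
Implicit Types (q r : quad R) (a b c d : 'cV[R]_2) (n : nat).
Notation T := (@chebT R).
Notation U := (@chebU R).

Lemma Mq_qone : Mq (@qone R) = 1.
Proof. by rewrite /Mq /qone !expr0n /= !mul0r !addr0 expr1n. Qed.

Lemma qmulZl (k : R) q r : qmul (k *: q) r = k *: qmul q r.
Proof.
case: q r => [[[a b] c] d] [[[a' b'] c'] d'].
rewrite -[_ *: _ in LHS]/(k *: a, k *: b, k *: c, k *: d) /qmul.
rewrite -[_ *: _ in RHS]/(k *: _, k *: _, k *: _, k *: _) -!mul_polyC.
by move: (k%:P) => z; congr (_, _, _, _) => /=; ring.
Qed.

Lemma Mq_normalize (k : R) q : 0 < k -> Mq q = k%:P -> Mq ((Num.sqrt k)^-1 *: q) = 1.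
Proof.
move=> k0 Mk; rewrite MqZ exprVn sqr_sqrtr ?ltW // Mk -mul_polyC -polyCM mulVf //.
by rewrite gt_eqF.
Qed.

Lemma inQZ n (k : R) q : inQ n q -> inQ n (k *: q).
Proof.
case: q => [[[a b] c] d] [sa sb sc sd].
rewrite -[_ *: _]/(k *: a, k *: b, k *: c, k *: d).
by split; rewrite (leq_trans (size_scale_leq _ _)).
Qed.

Section Step.
Variables (n : nat) (r : quad R) (a b c d : 'cV[R]_2).
Hypotheses (rlow : inLow n r) (E2 : formA a b c d = 0) (E11 : formB a b c d = 0).
Let qh := r + qtop n.+1 a b c d.

Lemma inQ_drop_top : a 0 0 = 0 -> b 0 0 = 0 -> c 0 0 = 0 -> d 0 0 = 0 -> inQ n qh.
Proof.
move=> a0 b0 c0 d0; rewrite /qh; case: r rlow => [[[ra rb] rc] rd] [sa sb sc sd].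
rewrite /qtop /topT /topU a0 b0 c0 d0 !scale0r !add0r.
rewrite -[_ + _]/(ra + a 1 0 *: T n, rb + b 1 0 *: U n, rc + c 1 0 *: T n, rd + d 1 0 *: U n).
have h k (p : {poly R}) : (size p <= k)%N -> forall x : R, (size (x *: p)%R <= k)%N.
  by move=> ? x; rewrite (leq_trans (size_scale_leq _ _)).
by split; rewrite (leq_trans (size_polyD _ _)) // geq_max h ?size_chebT ?size_chebU_le // andbT;
  lia.
Qed.

Definition factor_raw (al1 al0 be1 ga1 ga0 de1 : R) : quad R :=
  (al1 *: T 1 + al0%:P, be1 *: U 1, ga1 *: T 1 + ga0%:P, de1 *: U 1).

Lemma Mq_factor_raw (al1 al0 be1 ga1 ga0 de1 : R) :
  al1 ^+ 2 + ga1 ^+ 2 = be1 ^+ 2 + de1 ^+ 2 -> al1 * al0 + ga1 * ga0 = 0 ->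
  Mq (factor_raw al1 al0 be1 ga1 ga0 de1) =
  (al0 ^+ 2 + ga0 ^+ 2 + (al1 ^+ 2 + be1 ^+ 2 + ga1 ^+ 2 + de1 ^+ 2) / 2)%:P.
Proof.
move=> h2 h1.
have -> : factor_raw al1 al0 be1 ga1 ga0 de1 =
    qtop 1 (col2 al1 al0) (col2 be1 0) (col2 ga1 ga0) (col2 de1 0).
  have TE x y : topT 1 (col2 x y) = x *: T 1 + y%:P.
    by rewrite /topT /col2 !mxE /= alg_polyC.
  have UE x : topU 1 (col2 x 0) = x *: U 1.
    by rewrite /topU /col2 !mxE /= scale0r addr0.
  by rewrite /qtop !TE !UE.
rewrite Mq_qtop.
have -> : cross_sum (col2 al1 al0) (col2 be1 0) (col2 ga1 ga0) (col2 de1 0) = 0.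
  by rewrite /cross_sum /col2 !mxE /=; lra.
have -> : formB (col2 al1 al0) (col2 be1 0) (col2 ga1 ga0) (col2 de1 0) = 0.
  by rewrite /formB /col2 !mxE /=; lra.
have -> : formA (col2 al1 al0) (col2 be1 0) (col2 ga1 ga0) (col2 de1 0) = 0.
  by rewrite /formA /col2 !mxE /=; lra.
rewrite mul0r !scale0r !addr0 [T (0 + 0)]/(1) alg_polyC -polyCD; congr (_%:P).
by rewrite /sqnorm8 /formA_low /col2 !mxE /=; field.
Qed.

Lemma inQ_factor_raw_mul (al1 al0 be1 ga1 ga0 de1 : R) : (0 < n)%N ->
  let e := factor_raw al1 al0 be1 ga1 ga0 de1 in
  al1 = a 0 0 -> be1 = - b 0 0 -> ga1 = - c 0 0 -> de1 = - d 0 0 ->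
  al0 * a 0 0 - ga0 * c 0 0 = 0 ->
  2 * (al0 * b 0 0 + ga0 * d 0 0) = b 0 0 * a 1 0 - a 0 0 * b 1 0 - d 0 0 * c 1 0 + c 0 0 * d 1 0 ->
  2 * (ga0 * a 0 0 + al0 * c 0 0) = c 0 0 * a 1 0 - a 0 0 * c 1 0 - d 0 0 * b 1 0 + b 0 0 * d 1 0 ->
  2 * (al0 * d 0 0 - ga0 * b 0 0) = d 0 0 * a 1 0 - a 0 0 * d 1 0 + b 0 0 * c 1 0 - c 0 0 * b 1 0 ->
  inQ n (qmul e qh).
Proof.
move=> n0 e ea eb ec ed h1 h2 h3 h4.
rewrite /qh; case: r rlow => [[[ra rb] rc] rd] [sa sb sc sd].
rewrite -[_ + _]/(ra + topT n.+1 a, rb + topU n.+1 b, rc + topT n.+1 c, rd + topU n.+1 d).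
rewrite /e /factor_raw /qmul.
move: E2 E11; rewrite /formA /formB => e2 e11.
split.
- apply: lead2_size (lead2D (lead2D (lead2D (lead2_TT n0 al1 al0 a sa)
    (lead2N (lead2_UU n0 be1 b sb))) (lead2N (lead2_TT n0 ga1 ga0 c sc)))
    (lead2N (lead2_UU n0 de1 d sd))).
  + by rewrite ea eb ec ed; lra.
  + by rewrite ea eb ec ed; lra.
- apply: lead2_size (lead2D (lead2D (lead2D (lead2_UT n0 be1 a sa)
    (lead2_TU n0 al1 al0 b sb)) (lead2N (lead2_UT n0 de1 c sc)))
    (lead2_TU n0 ga1 ga0 d sd)).
  + by rewrite ea eb ec ed; lra.
  + by rewrite ea eb ec ed; lra.
- apply: lead2_size (lead2D (lead2D (lead2D (lead2_TT n0 ga1 ga0 a sa)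
    (lead2_UU n0 de1 b sb)) (lead2_TT n0 al1 al0 c sc))
    (lead2N (lead2_UU n0 be1 d sd))).
  + by rewrite ea eb ec ed; lra.
  + by rewrite ea eb ec ed; lra.
- apply: lead2_size (lead2D (lead2D (lead2D (lead2_UT n0 de1 a sa)
    (lead2N (lead2_TU n0 ga1 ga0 b sb))) (lead2_UT n0 be1 c sc))
    (lead2_TU n0 al1 al0 d sd)).
  + by rewrite ea eb ec ed; lra.
  + by rewrite ea eb ec ed; lra.
Qed.

(** The vanishing of [formA] and [formB] makes M(e) constant before
    normalization, and is also what cancels the two leading coefficients of the
    four components of e q.  The three cases are those of the definition of
    phi: e = 1, degree 1, and the generic one. *)
Lemma phi_factor : (n = 0%N -> b 1 0 = 0) -> (n = 0%N -> d 1 0 = 0) ->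
  Mq (phi_fun n.+1 qh) = 1 /\ inQ n (qmul (phi_fun n.+1 qh) qh).
Proof.
move=> b0 d0; set e := phi_fun _ _.
case rE : r rlow => [[[ra rb] rc] rd] [sa sb sc sd].
have qhE : qh = (ra + topT n.+1 a, rb + topU n.+1 b, rc + topT n.+1 c, rd + topU n.+1 d).
  by rewrite /qh rE.
have [Ta Ta'] := chebT_coef_top a sa; have [Tc Tc'] := chebT_coef_top c sc.
move: E2 E11; rewrite /formA /formB => e2 e11.
have [s0|s0] := eqVneq (a 0 0 ^+ 2 + c 0 0 ^+ 2) 0.
  have eE : e = qone by rewrite /e qhE /phi_fun Ta Tc s0 eqxx.
  rewrite eE qmul1l Mq_qone; split=> //.
  have sq0 (x y : R) : x ^+ 2 + y ^+ 2 = 0 -> x = 0 /\ y = 0.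
    move=> /eqP; rewrite paddr_eq0 ?sqr_ge0 // !sqrf_eq0.
    by move=> /andP[/eqP -> /eqP ->].
  have [a0 c0] := sq0 _ _ s0.
  have [|b00 d00] := sq0 (b 0 0) (d 0 0); first by move: e2; lra.
  exact: inQ_drop_top.
have spos : 0 < a 0 0 ^+ 2 + c 0 0 ^+ 2 by rewrite lt0r s0 addr_ge0 ?sqr_ge0.
have [n0|n0] := posnP n.
  pose k := sqnorm8 a b c d / 2 + formA_low a b c d / 2.
  have hb := b0 n0; have hd := d0 n0.
  have r0 : r = 0.
    move: sa sb sc sd; rewrite n0 !size_poly_leq0 rE.
    by move=> /eqP -> /eqP -> /eqP -> /eqP ->.
  have Mk : Mq qh = k%:P.
    rewrite /qh r0 add0r Mq_qtop E2 E11 n0 mul0r !scale0r !addr0.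
    have -> : cross_sum a b c d = 0 by move: e11; rewrite /cross_sum hb hd; lra.
    by rewrite scale0r addr0 [T (0 + 0)]/(1) alg_polyC -polyCD.
  have k0 : 0 < k.
    rewrite /k /sqnorm8 /formA_low hb hd; have := sqr_ge0 (b 0 0); have := sqr_ge0 (d 0 0).
    have := sqr_ge0 (a 1 0); have := sqr_ge0 (c 1 0); move: spos; lra.
  have eE : e = (Num.sqrt k)^-1 *: qconj qh.
    rewrite /e -[k](_ : (Mq qh)`_0 = k); last by rewrite Mk coefC.
    by rewrite qhE /phi_fun Ta Tc (negPf s0) n0.
  rewrite eE Mq_normalize ?Mq_qconj //; split=> //.
  rewrite qmulZl qmul_qconjl Mk n0; apply: inQZ; split; rewrite ?size_poly0 //.
  exact: size_polyC_leq1.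
have [Ub Ub'] := chebU_coef_top b sb n0; have [Ud Ud'] := chebU_coef_top d sd n0.
pose s := a 0 0 ^+ 2 + c 0 0 ^+ 2.
pose al0 := a 1 0 / 2 - (b 0 0 * b 1 0 + d 0 0 * d 1 0) / (2 * s) * a 0 0
                      + (b 0 0 * d 1 0 - d 0 0 * b 1 0) / (2 * s) * c 0 0.
pose ga0 := - c 1 0 / 2 + (b 0 0 * b 1 0 + d 0 0 * d 1 0) / (2 * s) * c 0 0
                      + (b 0 0 * d 1 0 - d 0 0 * b 1 0) / (2 * s) * a 0 0.
pose k := al0 ^+ 2 + ga0 ^+ 2
   + (a 0 0 ^+ 2 + (- b 0 0) ^+ 2 + (- c 0 0) ^+ 2 + (- d 0 0) ^+ 2) / 2.
pose e0 := factor_raw (a 0 0) al0 (- b 0 0) (- c 0 0) ga0 (- d 0 0).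
have eE : e = (Num.sqrt k)^-1 *: e0.
  rewrite /e qhE /phi_fun Ta Tc Ub Ud (negPf s0) eqSS (gtn_eqF n0).
  by rewrite -[n.+1.-1]/n Ta' Tc' Ub' Ud'.
have sE : s = b 0 0 ^+ 2 + d 0 0 ^+ 2 by rewrite /s; lra.
have s0' : s != 0 by [].
have h1 : al0 * a 0 0 - ga0 * c 0 0 = 0.
  have -> : al0 * a 0 0 - ga0 * c 0 0 =
    (a 0 0 * a 1 0 - b 0 0 * b 1 0 + (c 0 0 * c 1 0 - d 0 0 * d 1 0)) / 2.
    by rewrite /al0 /ga0 /s; field.
  by rewrite e11 mul0r.
have k0 : 0 < k.
  rewrite /k !sqrrN; have := sqr_ge0 al0; have := sqr_ge0 ga0.
  have := sqr_ge0 (b 0 0); have := sqr_ge0 (d 0 0); move: spos; lra.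
have Mk : Mq e0 = k%:P.
  apply: Mq_factor_raw; first by move: e2; rewrite !sqrrN; lra.
  by move: h1; lra.
rewrite eE (Mq_normalize k0 Mk); split=> //.
rewrite qmulZl; apply: inQZ; apply: inQ_factor_raw_mul => //.
- have -> : 2 * (al0 * b 0 0 + ga0 * d 0 0) = a 1 0 * b 0 0 - c 1 0 * d 0 0
     + (c 0 0 * d 1 0 - a 0 0 * b 1 0) * ((b 0 0 ^+ 2 + d 0 0 ^+ 2) / s).
    by rewrite /al0 /ga0; field.
  by rewrite -sE divff //; ring.
- have -> : 2 * (ga0 * a 0 0 + al0 * c 0 0) = a 1 0 * c 0 0 - c 1 0 * a 0 0
     + (b 0 0 * d 1 0 - d 0 0 * b 1 0) * ((a 0 0 ^+ 2 + c 0 0 ^+ 2) / s).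
    by rewrite /al0 /ga0; field.
  by rewrite -/s divff //; ring.
- have -> : 2 * (al0 * d 0 0 - ga0 * b 0 0) = a 1 0 * d 0 0 + c 1 0 * b 0 0
     - (a 0 0 * d 1 0 + c 0 0 * b 1 0) * ((b 0 0 ^+ 2 + d 0 0 ^+ 2) / s).
    by rewrite /al0 /ga0; field.
  by rewrite -sE divff //; ring.
Qed.

End Step.
End Factorization.

(** * Induction on the degree *)

Section Gauge.
Context {R : realType}.
Implicit Types (x y s t : R) (n : nat).

Definition maxpow s x : R := Num.max x (x `^ s).

Lemma powR_le_maxpow s t x : 0 < s -> s <= t -> t <= 1 -> 0 <= x ->
  x `^ t <= maxpow s x.
Proof.
move=> s0 st t1; rewrite le_eqVlt => /predU1P[<-|x0].
  by rewrite powR0 ?gt_eqF ?(lt_le_trans s0 st) // /maxpow powR0 ?gt_eqF // maxxx.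
rewrite /maxpow le_max; have [x1|x1] := leP x 1.
  by rewrite ger_powR ?orbT // x0.
by rewrite (le_trans (ler_powR (ltW x1) t1)) // powRr1 // ltW.
Qed.

Lemma le_maxpow s x y : 0 < s -> 0 <= x -> x <= y -> maxpow s x <= maxpow s y.
Proof.
move=> s0 x0 xy; have y0 := le_trans x0 xy.
rewrite /maxpow ge_max !le_max xy /=.
by rewrite [X in _ || X]ge0_ler_powR ?orbT // ?nnegrE // ltW.
Qed.

Lemma maxpow_sqrt s t x : 0 < s -> s <= t / 2 -> t <= 1 -> 0 <= x ->
  maxpow t (Num.sqrt x) <= maxpow s x.
Proof.
move=> s0 st t1 x0.
rewrite {1}/maxpow -powR12_sqrt // -powRrM ge_max !powR_le_maxpow //; lra.
Qed.

(** The recursion x' <= sqrt x halves the exponent at each step; this exponent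
    decreases at least that fast. *)
Definition gauge_exp n : R := 2 ^- (2 * n).+1.

Lemma gauge_exp_gt0 n : 0 < gauge_exp n.
Proof. by rewrite /gauge_exp invr_gt0 exprn_gt0. Qed.

Lemma gauge_exp_le n : gauge_exp n <= 2^-1.
Proof. by rewrite lef_pV2 ?posrE ?exprn_gt0 // -[leLHS]expr1 ler_weXn2l // ler1n. Qed.

Lemma gauge_expS n : gauge_exp n.+1 <= gauge_exp n / 2.
Proof.
have g0 := gauge_exp_gt0 n; have -> : gauge_exp n.+1 = gauge_exp n / 2 / 2.
  rewrite /gauge_exp (_ : (2 * n.+1).+1 = (2 * n).+3)%N; last by lia.
  by rewrite 2![in LHS]exprS !invfM; ring.
by rewrite ler_piMr ?invf_le1 ?ler1n // ltW // divr_gt0.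
Qed.

End Gauge.

Section Projection.
Context {R : realType}.
Implicit Types (q r : quad R) (n : nat).

Lemma pnormC_ge (k : R) : `|k| * pi <= pnorm k%:P.
Proof.
have := @norm_cintM_le R k%:P 1; rewrite mulr1 -alg_polyC cintZ.
rewrite [in cint 1](_ : 1 = chebT 0) // cint_chebT eqxx normrM (ger0_norm (pi_ge0 R)).
by rewrite alg_polyC; apply=> t; rewrite hornerE normr1.
Qed.

Lemma cintC (k : R) : cint k%:P = k * pi.
Proof.
by rewrite -alg_polyC cintZ [in cint 1](_ : 1 = chebT 0) // cint_chebT eqxx.
Qed.

Lemma sqrt_pi_le : Num.sqrt pi <= pi :> R.
Proof.
have p2 := pi_ge2 R; have p0 := pi_ge0 R.
rewrite -[leRHS](ger0_norm p0) -sqrtr_sqr ler_sqrt ?sqr_ge0 // expr2.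
by rewrite ler_peMl //; lra.
Qed.

(** Here M(q) is a constant m, and |sqrt m - 1| <= |m - 1|. *)
Lemma normalize0_dist q : inQ 0 q -> qnorm (q - normalize0 q) <= pnorm (qeps q).
Proof.
move=> q0.
have [m m0 Mm] : exists2 m, 0 <= m & Mq q = m%:P.
  case: q q0 => [[[a b] c] d] [sa + sc +]; rewrite !size_poly_leq0 => /eqP -> /eqP ->.
  rewrite (size1_polyC sa) (size1_polyC sc).
  exists (a`_0 ^+ 2 + c`_0 ^+ 2); first by rewrite addr_ge0 ?sqr_ge0.
  by rewrite /Mq expr0n /= mul0r !addr0 polyCD !rmorphXn.
have epsE : qeps q = (m - 1)%:P by rewrite /qeps Mm polyCB.
apply: (le_trans _ (_ : `|m - 1| * pi <= _)); last by rewrite epsE pnormC_ge.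
(* sqrt pi is the norm of the unit quadruplet, pi that of the polynomial 1 *)
have bound (x : R) : 0 <= x -> x <= `|m - 1| -> x * Num.sqrt pi <= `|m - 1| * pi.
  by move=> x0 xm; apply: ler_pM; rewrite ?sqrtr_ge0 // sqrt_pi_le.
have NE (r : quad R) (k : R) : Mq r = (k ^+ 2)%:P -> 0 <= k -> qnorm r = k * Num.sqrt pi.
  move=> Mr k0; rewrite /qnorm pnorm_Mq Mr cintC sqrtrM ?sqr_ge0 //.
  by rewrite sqrtr_sqr ger0_norm.
rewrite /normalize0; case: eqP => [q00|/eqP qn0].
  have m00 : m = 0.
    move: Mm; rewrite q00 -(scale0r (0 : quad R)) MqZ expr0n scale0r.
    by move/eqP; rewrite eq_sym polyC_eq0 => /eqP.
  rewrite q00 sub0r (NE _ 1) ?MqN ?Mq_qone ?expr1n //; apply: bound => //.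
  by rewrite m00 sub0r normrN normr1.
rewrite Mm coefC /=; set s := Num.sqrt m.
have [m00|mn0] := eqVneq m 0.
  case/negP: qn0; apply/eqP.
  move: Mm; rewrite m00; case: q q0 {epsE} => [[[a b] c] d] [sa + sc +].
  rewrite !size_poly_leq0 => /eqP -> /eqP ->.
  rewrite (size1_polyC sa) (size1_polyC sc) /Mq expr0n /= mul0r !addr0 -!rmorphXn /= -polyCD.
  move/eqP; rewrite polyC_eq0 paddr_eq0 ?sqr_ge0 // !sqrf_eq0 => /andP[/eqP -> /eqP ->].
  by [].
have s0 : 0 < s by rewrite sqrtr_gt0 lt0r mn0.
have sm : s ^+ 2 = m by rewrite sqr_sqrtr.
have -> : q - s^-1 *: q = (1 - s^-1) *: q by rewrite scalerBl scale1r.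
rewrite (NE _ `|s - 1|) //; last first.
  rewrite MqZ Mm real_normK ?num_real // -mul_polyC -polyCM -sm; congr (_%:P).
  by field; rewrite gt_eqF.
apply: bound => //.
have -> : m - 1 = (s - 1) * (s + 1) by rewrite -sm; ring.
by rewrite normrM ler_peMr // ger0_norm; lra.
Qed.

Lemma pnorm_qeps_le q : pnorm (qeps q) <= qnorm q ^+ 2 + pi.
Proof.
rewrite qnorm_sqr -pnorm_Mq (le_trans (ler_pnormD _ _)) // lerD2l.
rewrite -[leRHS](_ : cint 1 = pi); last by rewrite -[1]/(1%:P) cintC mul1r.
by apply: pnorm_le_cint => t; rewrite !hornerE normrN normr1.
Qed.

Variables (chi8 : 'cV[R]_((2 + 2) + (2 + 2)) -> 'cV[R]_((2 + 2) + (2 + 2)))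
          (chi6 : 'cV[R]_((2 + 1) + (2 + 1)) -> 'cV[R]_((2 + 1) + (2 + 1))).
Hypotheses (hchi8 : correction_map A8 B8 S8 chi8)
           (hchi6 : correction_map A6 B6 S6 chi6).

Lemma projection_step n q : inQ n.+1 q ->
  let qh := chi_fun chi8 chi6 n.+1 q in let e := phi_fun n.+1 qh in
  [/\ Mq e = 1, inQ n (qmul e qh),
      qnorm (q - qh) <= 4 * Num.sqrt (pnorm (qeps q))
    & qnorm qh <= (if n == 0%N then 2 else 1) * qnorm q].
Proof.
move=> qQ qh e.
have [a [b [c [d [a' [b' [c' [d' [qE qhE tc]]]]]]]]] := chi_fun_split hchi8 hchi6 qQ.
have rl := inLow_qlow n q.
have [Me eQ] := phi_factor rl (tc_dif2 tc) (tc_dif11 tc)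
  (fun h => proj2 (tc_b0 tc h)) (fun h => proj2 (tc_d0 tc h)).
have N1 := correction_dist rl tc; have N2 := correction_norm rl tc.
rewrite -qE -qhE -/qh in Me eQ N1 N2.
split=> //.
rewrite -(@ler_pXn2r _ 2) ?nnegrE ?qnorm_ge0 ?mulr_ge0 ?sqrtr_ge0 //.
rewrite exprMn (sqr_sqrtr (pnorm_ge0 (qeps q))) (le_trans N1) //.
by rewrite ler_wpM2r ?pnorm_ge0 //; lra.
Qed.

Section Induction.
Variables (H : R) (H0 : 0 < H).

(** A factor c with ||defect of the corrected q|| <= c sqrt ||defect of q||:
    the first root absorbs one power of sqrt eta, as eta <= H^2 + pi, and
    12 H = 4 (2 H + H) comes from the distance and the norms in Cauchy-Schwarz; the
    summand 1 ensures c >= 1. *)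
Definition step_const : R := 1 + Num.sqrt (H ^+ 2 + pi) + 12 * H.

Lemma step_const_ge1 : 1 <= step_const.
Proof.
rewrite /step_const; have h0 := H0; have := sqrtr_ge0 (H ^+ 2 + pi).
by move: (Num.sqrt _) => s s0; lra.
Qed.

(** The bound on the norm is only required in positive degree: the step from
    degree 1 to degree 0 may double the norm, but the last normalization is
    controlled by the defect alone. *)
Lemma qproj_dist n q : inQ n q -> ((0 < n)%N -> qnorm q <= H) ->
  qnorm (q - qproj chi8 chi6 n q) <=
  n.+1%:R * (4 * step_const ^+ 2) *
    maxpow (gauge_exp n) (pnorm (qeps q) / step_const ^+ 2).
Proof.
set c := step_const; have c1 : 1 <= c := step_const_ge1.
have c0 : 0 < c by lra.
elim: n q => [|n IH] q qQ qH.
  rewrite mul1r (le_trans (normalize0_dist qQ)) //.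
  set x := _ / _; have -> : pnorm (qeps q) = c ^+ 2 * x.
    by rewrite /x mulrC divfK // expf_neq0 // gt_eqF.
  have x0 : 0 <= x by rewrite divr_ge0 ?pnorm_ge0 ?sqr_ge0.
  apply: ler_pM; rewrite ?sqr_ge0 //; last by rewrite /maxpow le_max lexx.
  by have := sqr_ge0 c; lra.
have [/= Me eQ N1 N2] := projection_step qQ.
move: Me eQ N1 N2; set qh := chi_fun _ _ _ _; set e := phi_fun _ _ => Me eQ N1 N2.
have {}qH := qH isT.
have N2' : qnorm qh <= 2 * qnorm q.
  by apply: (le_trans N2); rewrite ler_wpM2r ?qnorm_ge0 //; case: ifP => _; lra.
set eta := pnorm (qeps q) in N1 *; have eta0 : 0 <= eta by exact: pnorm_ge0.
set y := Num.sqrt eta in N1; have y0 : 0 <= y by exact: sqrtr_ge0.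
have yE : y ^+ 2 = eta by rewrite sqr_sqrtr.
have q0 := qnorm_ge0 q.
have yB : y <= Num.sqrt (H ^+ 2 + pi).
  have Hpi : 0 <= H ^+ 2 + pi by apply: addr_ge0; [exact: sqr_ge0|exact: pi_ge0].
  rewrite ler_sqrt //; apply: (le_trans (pnorm_qeps_le q)); rewrite lerD2r.
  by rewrite ler_pXn2r ?nnegrE // ltW.
have eta'B : pnorm (qeps (qmul e qh)) <= c * y.
  rewrite /qeps Mq_qmul Me mul1r.
  have -> : Mq qh - 1 = (Mq q - 1) + (Mq qh - Mq q) by ring.
  apply: (le_trans (ler_pnormD _ _)).
  have h1 := pnorm_sub_Mq_le qh q.
  have h2 : qnorm (qh - q) = qnorm (q - qh) by rewrite -qnormN opprB.
  rewrite h2 in h1.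
  have h3 : qnorm (q - qh) * (qnorm qh + qnorm q) <= 4 * y * (3 * H).
    apply: ler_pM => //; first exact: qnorm_ge0.
      by rewrite addr_ge0 ?qnorm_ge0.
    by move: N2' qH; move: (qnorm qh) (qnorm q) => u v; lra.
  have h4 : y * y <= Num.sqrt (H ^+ 2 + pi) * y by rewrite ler_wpM2r.
  apply: (le_trans (lerD (lexx _) (le_trans h1 h3))).
  rewrite -/(qeps q) -/eta -yE /c /step_const expr2.
  by move: h4 y0; move: (Num.sqrt (H ^+ 2 + pi)) => s h4 y00; lra.
set x := eta / c ^+ 2.
have x0 : 0 <= x by rewrite divr_ge0 ?sqr_ge0.
have sx : Num.sqrt x = y / c.
  by rewrite /x sqrtrM // sqrtrV ?sqr_ge0 // sqrtr_sqr ger0_norm // ltW.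
have g0 := @gauge_exp_gt0 R n; have gS := @gauge_expS R n; have g1 := @gauge_exp_le R n.
have gS0 := @gauge_exp_gt0 R n.+1; have gS1 := @gauge_exp_le R n.+1.
have rest : maxpow (gauge_exp n) (pnorm (qeps (qmul e qh)) / c ^+ 2)
            <= maxpow (gauge_exp n.+1) x.
  apply: (le_trans _ (_ : maxpow (gauge_exp n) (Num.sqrt x) <= _)).
    apply: le_maxpow => //; first by rewrite divr_ge0 ?pnorm_ge0 ?sqr_ge0.
    rewrite sx ler_pdivrMr ?exprn_gt0 //.
    have -> : y / c * c ^+ 2 = c * y by field; rewrite gt_eqF.
    by [].
  by apply: maxpow_sqrt => //; lra.
have IHq : qnorm (qmul e qh - qproj chi8 chi6 n (qmul e qh)) <=
    n.+1%:R * (4 * c ^+ 2) * maxpow (gauge_exp n.+1) x.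
  apply: (le_trans (IH _ eQ _)).
    move=> n0; rewrite qnorm_qmul // (le_trans N2) // gtn_eqF // mul1r //.
  by rewrite ler_wpM2l // mulr_ge0 // mulr_ge0 // sqr_ge0.
have first : qnorm (q - qh) <= 4 * c ^+ 2 * maxpow (gauge_exp n.+1) x.
  apply: (le_trans N1).
  have -> : y = c * Num.sqrt x by rewrite sx; field; rewrite gt_eqF.
  have h : Num.sqrt x <= maxpow (gauge_exp n.+1) x.
    by rewrite -powR12_sqrt // powR_le_maxpow //; lra.
  rewrite expr2 -!mulrA !ler_pM2l //; apply: (le_trans h).
  by rewrite ler_peMl // (le_trans x0) // /maxpow le_max lexx.
have -> : q - qproj chi8 chi6 n.+1 q =
    (q - qh) + qmul (qconj e) (qmul e qh - qproj chi8 chi6 n (qmul e qh)).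
  rewrite qmulBr qmul_qconjK // addrA subrK.
  by [].
apply: (le_trans (ler_qnormD _ _)); rewrite qnorm_qmul ?Mq_qconj //.
apply: (le_trans (lerD first IHq)).
by rewrite -[n.+2]add1n natrD; lra.
Qed.

End Induction.
End Projection.

Theorem theorem4p1 (R : realType) (H : R) (hH : 0 < H) :
  exists2 C : R, 0 < C &
  forall (chi8 : 'cV[R]_((2 + 2) + (2 + 2)) -> 'cV[R]_((2 + 2) + (2 + 2)))
         (chi6 : 'cV[R]_((2 + 1) + (2 + 1)) -> 'cV[R]_((2 + 1) + (2 + 1))),
  correction_map A8 B8 S8 chi8 -> correction_map A6 B6 S6 chi6 ->
  forall (n : nat) (q : quad R), inQ n q -> qnorm q <= H ->
  qnorm (q - qproj chi8 chi6 n q) <=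
    n.+1%:R * C *
    Num.max (pnorm (qeps q)) (pnorm (qeps q) `^ (2 ^- (2 * n).+1)).
Proof.
have c1 := step_const_ge1 hH.
have c0 : 0 < step_const H ^+ 2 by rewrite exprn_gt0 //; lra.
exists (4 * step_const H ^+ 2); first by rewrite mulr_gt0.
move=> chi8 chi6 h8 h6 n q qQ qH.
apply: (le_trans (qproj_dist h8 h6 hH qQ (fun=> qH))).
apply: ler_wpM2l; first by apply: mulr_ge0 => //; apply: mulr_ge0 => //; exact: ltW.
apply: (@le_maxpow R (gauge_exp n)); first exact: gauge_exp_gt0.
  by rewrite divr_ge0 ?pnorm_ge0 // ltW.
rewrite ler_pdivrMr // ler_peMr ?pnorm_ge0 // exprn_ege1 //.
Qed.
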